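(* Consider the switched descriptor system $E_{\sigma(t)}\dot x=A_{\sigma(t)}x$, $\sigma(t)\in\{1,2\}$, with $E_i,A_i\in\mathbb{R}^{n\times n}$, $A_1,A_2$ nonsingular, in which every solution $x(\cdot)$ is continuous at the switching instants (i.e. $x(t_*^+)=x(t_*^-)$). Suppose: (a) $(E_1,A_1)$ and $(E_2,A_2)$ are stable; (b) $(E_1,A_1)$ has index zero and $(E_2,A_2)$ has index one; (c) there exist column vectors $g,h\in\mathbb{R}^n$ with $A_2^{-1}E_2=A_1^{-1}E_1-gh^T$, where $(A_1^{-1}E_1,g)$ is controllable and $(A_1^{-1}E_1,h)$ is observable (i.e. $(h^T,A_1^{-1}E_1)$ is an observable pair); (d) the matrix $A_1^{-1}E_1A_2^{-1}E_2$ has no negative real eigenvalues and exactly one zero eigenvalue. Then the switched system is GUES.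
   Context: For $E,A\in\mathbb{R}^{n\times n}$ with $A$ nonsingular, $(E,A)$ denotes the descriptor system $E\dot x=Ax$. It is stable if every root $s$ of $\det(sE-A)=0$ has negative real part. Its index is the smallest integer $k^*\ge0$ with $\mathrm{Im}((A^{-1}E)^{k^*+1})=\mathrm{Im}((A^{-1}E)^{k^*})$ (index zero means $E$ nonsingular), and its consistency space is $\mathcal{C}(E,A)=\mathrm{Im}((A^{-1}E)^{k^*})$. Switched descriptor system: the switching signal $\sigma$ is piecewise constant with finitely many discontinuities in every bounded interval; a solution $x(\cdot)$ is differentiable and satisfies $E_{\sigma(t)}\dot x(t)=A_{\sigma(t)}x(t)$ at every $t$ where $\sigma$ is continuous, with one-sided limits at the discontinuities of $\sigma$ (the equation is not required at those instants). The system is GUES if there exist $\beta,\alpha>0$ such that every solution satisfies $\|x(t)\|\le\beta e^{-\alpha(t-t_0)}\|x(t_0)\|$ for all $t\ge t_0$. *)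

(* Defs.v *)
(* Stdlib (classical reals).  Matrices are represented as
   functions nat -> nat -> R (only indices < n are meaningful),
   vectors as nat -> R. *)
From Stdlib Require Import Reals List.
Open Scope R_scope.

Definition Mat := nat -> nat -> R.
Definition Vec := nat -> R.

Fixpoint rsum (n : nat) (f : nat -> R) : R :=
  match n with O => 0 | S m => rsum m f + f m end.

Definition idm : Mat := fun i j => if Nat.eqb i j then 1 else 0.
Definition mmul (n : nat) (A B : Mat) : Mat :=
  fun i j => rsum n (fun k => A i k * B k j).
Definition mvec (n : nat) (A : Mat) (x : Vec) : Vec :=
  fun i => rsum n (fun k => A i k * x k).
Fixpoint mpow (n : nat) (M : Mat) (k : nat) : Mat :=
  match k with O => idm | S k' => mmul n M (mpow n M k') end.

Definition is_inverse (n : nat) (A Ainv : Mat) : Prop :=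
  forall i j, (i < n)%nat -> (j < n)%nat ->
    mmul n A Ainv i j = idm i j /\ mmul n Ainv A i j = idm i j.

Definition minor {T : Type} (j : nat) (M : nat -> nat -> T) : nat -> nat -> T :=
  fun a b => M (S a) (if Nat.ltb b j then b else S b).

Fixpoint detR (n : nat) (M : Mat) : R :=
  match n with
  | O => 1
  | S m => rsum (S m) (fun j => (-1) ^ j * M O j * detR m (minor j M))
  end.

Record C := mkC { Cre : R; Cim : R }.
Definition C0 : C := mkC 0 0.
Definition Cadd (a b : C) : C := mkC (Cre a + Cre b) (Cim a + Cim b).
Definition Cmul (a b : C) : C :=
  mkC (Cre a * Cre b - Cim a * Cim b) (Cre a * Cim b + Cim a * Cre b).
Definition RtoC (r : R) : C := mkC r 0.
Fixpoint csum (n : nat) (f : nat -> C) : C :=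
  match n with O => C0 | S m => Cadd (csum m f) (f m) end.

Fixpoint detC (n : nat) (M : nat -> nat -> C) : C :=
  match n with
  | O => RtoC 1
  | S m => csum (S m) (fun j => Cmul (RtoC ((-1) ^ j)) (Cmul (M O j) (detC m (minor j M))))
  end.

Definition stable (n : nat) (E A : Mat) : Prop :=
  forall s : C,
    detC n (fun i j => Cadd (Cmul s (RtoC (E i j))) (RtoC (- A i j))) = C0 ->
    Cre s < 0.

Definition inIm (n : nat) (B : Mat) (y : Vec) : Prop :=
  exists x : Vec, forall i, (i < n)%nat -> y i = mvec n B x i.
Definition sameIm (n : nat) (B B' : Mat) : Prop :=
  forall y : Vec, inIm n B y <-> inIm n B' y.

Definition has_index (n : nat) (E Ainv : Mat) (k : nat) : Prop :=
  let M := mmul n Ainv E in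
  sameIm n (mpow n M (S k)) (mpow n M k) /\
  forall j, (j < k)%nat -> ~ sameIm n (mpow n M (S j)) (mpow n M j).

Definition controllable (n : nat) (M : Mat) (g : Vec) : Prop :=
  forall y : Vec, exists c : nat -> R, forall i, (i < n)%nat ->
    y i = rsum n (fun k => c k * mvec n (mpow n M k) g i).

Definition observable (n : nat) (M : Mat) (h : Vec) : Prop :=
  forall y : Vec, exists c : nat -> R, forall j, (j < n)%nat ->
    y j = rsum n (fun k => c k * rsum n (fun i => h i * mpow n M k i j)).

Definition charpoly (n : nat) (M : Mat) (lam : R) : R :=
  detR n (fun i j => lam * idm i j - M i j).

Definition vnorm (n : nat) (v : Vec) : R := sqrt (rsum n (fun i => v i ^ 2)).

Definition locconst (sigma : R -> nat) (t : R) : Prop :=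
  exists d, d > 0 /\ forall s, Rabs (s - t) < d -> sigma s = sigma t.

Definition switching_signal (sigma : R -> nat) : Prop :=
  (forall t, sigma t = 1%nat \/ sigma t = 2%nat) /\
  forall a b : R, exists L : list R,
    forall t, a <= t <= b -> ~ In t L -> locconst sigma t.

Definition sel (M1 M2 : Mat) (k : nat) : Mat :=
  if Nat.eqb k 1 then M1 else M2.

Definition is_solution (n : nat) (E1 A1 E2 A2 : Mat) (sigma : R -> nat)
  (t0 : R) (x : R -> Vec) : Prop :=
  (forall i, (i < n)%nat -> forall t, t0 < t -> continuity_pt (fun s => x s i) t) /\
  (forall i, (i < n)%nat -> forall eps, eps > 0 -> exists d, d > 0 /\
     forall s, t0 <= s < t0 + d -> Rabs (x s i - x t0 i) < eps) /\
  (forall t, t0 < t -> locconst sigma t ->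
     exists dx : Vec,
       (forall i, (i < n)%nat -> derivable_pt_lim (fun s => x s i) t (dx i)) /\
       (forall i, (i < n)%nat ->
          mvec n (sel E1 E2 (sigma t)) dx i = mvec n (sel A1 A2 (sigma t)) (x t) i)).

Definition GUES (n : nat) (E1 A1 E2 A2 : Mat) : Prop :=
  exists beta alpha : R, beta > 0 /\ alpha > 0 /\
    forall (sigma : R -> nat) (t0 : R) (x : R -> Vec),
      switching_signal sigma -> is_solution n E1 A1 E2 A2 sigma t0 x ->
      forall t, t0 <= t ->
        vnorm n (x t) <= beta * exp (- alpha * (t - t0)) * vnorm n (x t0).

(* Main.v *)
(* Put M = A1^-1 E1, A = M^-1, N = A2^-1 E2 = M - g h^T, b = A g, c = - A^T h.
   Since N is singular, h^T A g = 1, so in both modes x' = A x + b v with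
   v * (c^T x) = 0: v = 0 in mode 1, and c^T x = 0 in mode 2.  Hence x^T P x is a
   common strict Lyapunov function as soon as P > 0, A^T P + P A = - Q < 0 and
   P b = c, which is the strict Kalman-Yakubovich-Popov lemma for
   G(s) = c^T (s - A)^-1 b.  With a(s) = det(s - A), the numerator of
   G(s) + G(-s) over a(s) a(-s) is 2 det(A)^2 det(1 - s^2 M N); hypothesis (d)
   says that, as a polynomial in t = - s^2, it is positive on [0, oo[ and has
   degree n - 1.  It is therefore a sum of terms p(s) p(-s) with a positive
   definite Gram matrix; rewriting these p in the basis of the numerators of
   (s - A)^-1 b (controllability) gives Q, and the Lyapunov equation gives P. *)
Require Import Defs.
From Stdlib Require Import Reals Lra List ClassicalEpsilon.
From mathcomp Require all_boot all_order all_algebra spectral sesquilinear.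
From mathcomp Require complex polyrcf classical_sets reals topology normedtype.
From mathcomp Require derive Rstruct ssrAC ring lra zify.
Open Scope R_scope.

(** * Decay along switched trajectories *)

(** On the imaginary axis Re G(iw) is the numerator at t = w^2 divided by 2 |a(iw)|^2, so it decays
    like w^-2 and has no positive lower bound. Strictness is therefore read off the numerator:
    positivity on [0, oo[ and the full degree n - 1, which the simplicity of the zero eigenvalue
    provides, leave room to subtract e (1 + t + ... + t^(n-1)), and these n monomials make Q
    definite. A sum of para-squares takes the place of a spectral factor, so that only minima of
    real polynomials have to be controlled. P comes from the Lyapunov equation alone; P b = c is
    then forced, since a(s) and a(-s) have no common root. At switching instants, where the equation
    may fail, the continuity of x carries x^T P x across. *)

Lemma MVT_nonincreasing (f : R -> R) (a b : R) : a <= b ->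
  (forall t, a <= t <= b -> continuity_pt f t) ->
  (forall t, a < t < b -> exists l, derivable_pt_lim f t l /\ l <= 0) ->
  f b <= f a.
Proof.
intros ab cf df; destruct (Rle_lt_or_eq_dec a b ab) as [ab'| ->]; [|lra].
assert (pr : forall t, a < t < b -> derivable_pt f t).
{ intros t ht; destruct (constructive_indefinite_description _ (df t ht)) as [l [hl _]].
  now exists l. }
destruct (MVT f id a b pr (fun t _ => derivable_pt_id t) ab' cf
  (fun t _ => derivable_continuous_pt _ _ (derivable_pt_id t))) as [c [hc e]].
destruct (df c hc) as [l [hl l0]].
rewrite (derive_pt_eq_0 _ _ _ (pr c hc) hl), derive_pt_id in e; unfold id in e; nra.
Qed.

(** An excluded point inside the interval splits it into two, and at their common endpoint only
    continuity is asked for. *)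
Lemma nonincreasing_off_finite (L : list R) (f : R -> R) : forall a b : R, a <= b ->
  (forall t, a <= t <= b -> continuity_pt f t) ->
  (forall t, a < t < b -> ~ In t L -> exists l, derivable_pt_lim f t l /\ l <= 0) ->
  f b <= f a.
Proof.
induction L as [|c L IH]; intros a b ab cf df.
- apply MVT_nonincreasing; auto; intros t ht; apply df; auto.
- destruct (Rlt_dec a c) as [ac|ac]; [destruct (Rlt_dec c b) as [cb|cb]|].
  + apply Rle_trans with (f c).
    * apply IH; [lra|intros t ht; apply cf; lra|].
      intros t ht hL; apply df; [lra|intros [e|h]; [lra|auto]].
    * apply IH; [lra|intros t ht; apply cf; lra|].
      intros t ht hL; apply df; [lra|intros [e|h]; [lra|auto]].
  + apply IH; auto; intros t ht hL; apply df; auto; intros [e|h]; [lra|auto].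
  + apply IH; auto; intros t ht hL; apply df; auto; intros [e|h]; [lra|auto].
Qed.

Lemma rsum_plus (n : nat) (f g : nat -> R) :
  rsum n (fun i => f i + g i) = rsum n f + rsum n g.
Proof. induction n as [|n IH]; simpl; [lra|rewrite IH; lra]. Qed.

Lemma rsum_nonneg (n : nat) (f : nat -> R) : (forall i, 0 <= f i) -> 0 <= rsum n f.
Proof. intros f0; induction n as [|n IH]; simpl; [lra|specialize (f0 n); lra]. Qed.

Lemma continuity_pt_rsum (n : nat) (f : nat -> R -> R) (t : R) :
  (forall i, (i < n)%nat -> continuity_pt (f i) t) ->
  continuity_pt (fun s => rsum n (fun i => f i s)) t.
Proof.
induction n as [|n IH]; intros cf; simpl.
- apply continuity_pt_const; now intros x y.
- apply (continuity_pt_plus (fun s => rsum n (fun i => f i s)) (f n)); auto.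
Qed.

Lemma derivable_pt_lim_rsum (n : nat) (f : nat -> R -> R) (df : nat -> R) (t : R) :
  (forall i, (i < n)%nat -> derivable_pt_lim (f i) t (df i)) ->
  derivable_pt_lim (fun s => rsum n (fun i => f i s)) t (rsum n df).
Proof.
induction n as [|n IH]; intros cf; simpl.
- apply derivable_pt_lim_const.
- apply (derivable_pt_lim_plus (fun s => rsum n (fun i => f i s)) (f n)); auto.
Qed.

Definition bilin (n : nat) (P : Mat) (x z : Vec) : R :=
  rsum n (fun i => x i * mvec n P z i).

Lemma continuity_pt_bilin (n : nat) (P : Mat) (x : R -> Vec) (t : R) :
  (forall i, (i < n)%nat -> continuity_pt (fun s => x s i) t) ->
  continuity_pt (fun s => bilin n P (x s) (x s)) t.
Proof.
intros cx; apply (continuity_pt_rsum n (fun i s => x s i * mvec n P (x s) i)).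
intros i hi; apply (continuity_pt_mult (fun s => x s i)); [auto|].
apply (continuity_pt_rsum n (fun k s => P i k * x s k)); intros k hk.
apply (continuity_pt_scal (fun s => x s k)); auto.
Qed.

Lemma derivable_pt_lim_bilin (n : nat) (P : Mat) (x : R -> Vec) (dx : Vec) (t : R) :
  (forall i, (i < n)%nat -> derivable_pt_lim (fun s => x s i) t (dx i)) ->
  derivable_pt_lim (fun s => bilin n P (x s) (x s)) t
    (bilin n P (x t) dx + bilin n P dx (x t)).
Proof.
intros hx; unfold bilin; rewrite <- rsum_plus.
apply (derivable_pt_lim_rsum n (fun i s => x s i * mvec n P (x s) i)); intros i hi.
rewrite Rplus_comm.
apply (derivable_pt_lim_mult (fun s => x s i) (fun s => mvec n P (x s) i)); auto.
apply (derivable_pt_lim_rsum n (fun k s => P i k * x s k)); intros k hk.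
apply (derivable_pt_lim_scal (fun s => x s k)); auto.
Qed.

Section Trajectory.
Variables (n : nat) (E1 A1 E2 A2 P : Mat) (k1 k2 alpha : R).
Hypotheses (k1_pos : 0 < k1) (k2_pos : 0 < k2) (alpha_pos : 0 < alpha).
Hypothesis lower : forall x, k1 * rsum n (fun i => x i ^ 2) <= bilin n P x x.
Hypothesis upper : forall x, bilin n P x x <= k2 * rsum n (fun i => x i ^ 2).
Hypothesis decay : forall k x z, k = 1%nat \/ k = 2%nat ->
  (forall i, (i < n)%nat -> mvec n (sel E1 E2 k) z i = mvec n (sel A1 A2 k) x i) ->
  bilin n P x z + bilin n P z x <= - alpha * bilin n P x x.

(** [decay] makes exp(alpha t) x^T P x nonincreasing wherever sigma is locally constant; the other
    instants of [t0, t] are finitely many, and continuity bridges them. *)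
Lemma lyapunov_decay (sigma : R -> nat) (t0 : R) (x : R -> Vec) :
  switching_signal sigma -> is_solution n E1 A1 E2 A2 sigma t0 x ->
  forall t, t0 <= t ->
  bilin n P (x t) (x t) <= exp (- alpha * (t - t0)) * bilin n P (x t0) (x t0).
Proof.
intros [s12 sfin] [cx [rx dx]] t ht.
(* Freezing the trajectory before t0 turns right continuity at t0 into continuity. *)
pose (X := fun s => x (Rmax t0 s)).
assert (XE : forall s, t0 <= s -> X s = x s).
{ intros s hs; unfold X; now rewrite Rmax_right. }
pose (W := fun s => exp (alpha * s) * bilin n P (X s) (X s)).
assert (cX : forall i, (i < n)%nat -> forall s, t0 <= s -> continuity_pt (fun u => X u i) s).
{ intros i hi s hs; destruct (Rle_lt_or_eq_dec _ _ hs) as [lt|<-].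
  - apply (continuity_pt_locally_ext (fun u => x u i) _ (s - t0)); [lra| |auto].
    intros u hu; apply Rabs_def2 in hu; rewrite XE; [reflexivity|lra].
  - intros eps heps; destruct (rx i hi eps heps) as [d [hd Hd]].
    exists d; split; [exact hd|]; intros u [_ hu].
    change (Rabs (u - t0) < d) in hu; change (Rabs (X u i - X t0 i) < eps).
    rewrite (XE t0) by lra; apply Rabs_def2 in hu.
    destruct (Rle_lt_dec t0 u).
    + rewrite XE by lra; apply Hd; lra.
    + unfold X; rewrite Rmax_left, Rminus_diag, Rabs_R0; lra. }
assert (dexp : forall s, derivable_pt_lim (fun u => exp (alpha * u)) s (exp (alpha * s) * alpha)).
{ intros s; apply (derivable_pt_lim_comp (fun u => alpha * u) exp); [|apply derivable_pt_lim_exp].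
  pose proof (derivable_pt_lim_scal id alpha s 1 (derivable_pt_lim_id s)) as d.
  now rewrite Rmult_1_r in d. }
assert (Wle : W t <= W t0).
{ destruct (sfin t0 t) as [L hL].
  apply (nonincreasing_off_finite L); [exact ht| |].
  - intros s [hs _].
    apply (continuity_pt_mult (fun s => exp (alpha * s))).
    + apply derivable_continuous_pt; exists (exp (alpha * s) * alpha); apply dexp.
    + apply continuity_pt_bilin; auto.
  - intros s hs sL.
    destruct (dx s ltac:(lra) (hL s ltac:(lra) sL)) as [z [hz eqz]].
    exists (exp (alpha * s) * alpha * bilin n P (x s) (x s) +
            exp (alpha * s) * (bilin n P (x s) z + bilin n P z (x s))); split.
    + apply (derivable_pt_lim_locally_ext
        (fun u => exp (alpha * u) * bilin n P (x u) (x u)) _ s t0 t); [exact hs| |].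
      * intros u hu; unfold W; now rewrite XE by lra.
      * apply (derivable_pt_lim_mult (fun u => exp (alpha * u)) (fun u => bilin n P (x u) (x u)));
          [apply dexp|now apply derivable_pt_lim_bilin].
    + pose proof (decay (sigma s) (x s) z (s12 s) eqz); pose proof (exp_pos (alpha * s)); nra. }
unfold W in Wle; rewrite (XE t), (XE t0) in Wle by lra.
replace (- alpha * (t - t0)) with (alpha * t0 + - (alpha * t)) by ring.
rewrite exp_plus, exp_Ropp.
pose proof (exp_pos (alpha * t)).
apply Rmult_le_reg_l with (exp (alpha * t)); [auto|].
replace (exp (alpha * t) * (exp (alpha * t0) * / exp (alpha * t) * bilin n P (x t0) (x t0)))
  with (exp (alpha * t0) * bilin n P (x t0) (x t0)); [exact Wle|field; lra].
Qed.

Lemma gues_of_quadratic_lyapunov : GUES n E1 A1 E2 A2.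
Proof.
(* The norm is comparable to the square root of the quadratic form: this halves the rate and takes
   the root of the ratio of the two bounds. *)
exists (sqrt (k2 / k1)), (alpha / 2).
split; [|split]; [apply sqrt_lt_R0, Rdiv_lt_0_compat; assumption|lra|].
intros sigma t0 x hs hx t ht.
pose proof (lyapunov_decay sigma t0 x hs hx t ht) as V.
pose proof (lower (x t)) as hl; pose proof (upper (x t0)) as hu.
unfold vnorm; set (S := rsum n (fun i => x t i ^ 2)) in *.
set (S0 := rsum n (fun i => x t0 i ^ 2)) in *.
assert (S0_pos : 0 <= S0) by (apply rsum_nonneg; intros i; apply pow2_ge_0).
pose proof (exp_pos (- alpha * (t - t0))) as e0.
replace (exp (- (alpha / 2) * (t - t0))) with (sqrt (exp (- alpha * (t - t0)))).
2:{ apply sqrt_lem_1; [lra|left; apply exp_pos|]. rewrite <- exp_plus; f_equal; field. }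
assert (0 <= k2 / k1) by (left; apply Rdiv_lt_0_compat; assumption).
rewrite <- !sqrt_mult by (auto; try lra; apply Rmult_le_pos; lra).
apply sqrt_le_1_alt.
apply Rmult_le_reg_l with k1; [auto|].
replace (k1 * (k2 / k1 * exp (- alpha * (t - t0)) * S0)) with (exp (- alpha * (t - t0)) * (k2 * S0)) by (field; lra).
nra.
Qed.
End Trajectory.

Module CommonLyapunov.
Import all_boot all_order all_algebra spectral sesquilinear complex polyrcf.
Import classical_sets reals topology normedtype derive Rstruct.
Import ssrAC ring lra zify.
Import Order.TTheory GRing.Theory Num.Theory numFieldNormedType.Exports.
Set Implicit Arguments. Unset Strict Implicit. Unset Printing Implicit Defensive.
Local Open Scope ring_scope.
Local Notation toC := (map_mx (real_complex _)).

(** * Polynomials that are nonnegative on the half-line *)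

Lemma horner_min_segment (R : realType) (p : {poly R}) (a b : R) : a <= b ->
  exists2 c, a <= c <= b & forall t, a <= t <= b -> p.[c] <= p.[t].
Proof.
move=> ab; have cp : {within `[a, b], continuous (horner p)}%classic.
  by apply: continuous_subspaceT => x; exact: continuous_horner.
have [c + hc] := EVT_min ab cp.
by rewrite in_itv /= => cab; exists c.
Qed.

Lemma lead_coef_gt0_horner (F : rcfType) (p : {poly F}) : 0 < lead_coef p ->
  exists2 T, 0 < T & forall t, T <= t -> 0 < p.[t].
Proof.
move=> lp; have p0 : p != 0 by rewrite -lead_coef_eq0 gt_eqF.
exists (cauchy_bound p); first exact: cauchy_bound_gt0.
move=> t Tt; rewrite -sgr_cp0.
rewrite (sgp_pinftyP (ge_cauchy_bound p0)) ?in_itv /= ?Tt //.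
by rewrite /sgp_pinfty sgr_cp0.
Qed.

(* A negative value of p would persist near x0 by continuity. *)
Lemma horner_ge0_punctured (F : rcfType) (p : {poly F}) (x0 : F) (e : F) : 0 < e ->
  (forall x, x0 < x < x0 + e -> 0 <= p.[x]) -> 0 <= p.[x0].
Proof.
move=> e0 H; rewrite leNgt; apply/negP => px0.
have [d d0 Hd] := poly_cont x0 p (ltac:(by rewrite oppr_gt0) : 0 < - p.[x0]).
pose y := x0 + Num.min d e / 2.
have m0 : 0 < Num.min d e by rewrite lt_min d0 e0.
have /Hd : `|y - x0| < d.
  rewrite /y addrAC subrr add0r ger0_norm ?divr_ge0 ?ltW //.
  have: Num.min d e <= d by rewrite ge_min lexx.
  by lra.
have : 0 <= p.[y].
  apply: H; have: Num.min d e <= e by rewrite ge_min lexx orbT.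
  by rewrite /y => ?; apply/andP; split; lra.
by move=> py; rewrite ltr_norml => /andP[_]; lra.
Qed.

(** For real p, p(s) p(-s) is |p(s)|^2 on the imaginary axis. The size bound, n in the application,
    is the dimension in which each p is later represented by a row vector. *)
Definition para_sos (F : idomainType) (k : nat) (f : {poly F}) : Prop :=
  exists2 ps : seq {poly F}, all (fun p : {poly F} => size p <= k)%N ps &
    f = \sum_(p <- ps) p * (p \Po - 'X).

Lemma para_sos0 (F : idomainType) k : para_sos k (0 : {poly F}).
Proof. by exists [::] => //; rewrite big_nil. Qed.

Lemma para_sosD (F : idomainType) k (f g : {poly F}) :
  para_sos k f -> para_sos k g -> para_sos k (f + g).
Proof.
move=> [ps hp ->] [qs hq ->]; exists (ps ++ qs); first by rewrite all_cat hp.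
by rewrite big_cat.
Qed.

Lemma para_sosM (F : idomainType) k l (p f : {poly F}) :
  (size p <= l.+1)%N -> para_sos k f -> para_sos (l + k) (p * (p \Po - 'X) * f).
Proof.
move=> sp [qs /allP hq ->]; exists [seq p * q | q <- qs].
  apply/allP => _ /mapP[q /hq sq ->].
  by apply: (leq_trans (size_polyMleq _ _)); lia.
rewrite big_map big_distrr; apply: eq_bigr => q _ /=.
by rewrite rmorphM /=; ring.
Qed.

Lemma para_sosW (F : idomainType) k l (f : {poly F}) :
  (k <= l)%N -> para_sos k f -> para_sos l f.
Proof.
by move=> kl [ps /allP hp ->]; exists ps => //; apply/allP => p /hp /leq_trans; apply.
Qed.

Lemma para_sosC (F : rcfType) (c : F) : 0 <= c -> para_sos 1 c%:P.
Proof.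
move=> c0; exists [:: (Num.sqrt c)%:P] => /=; first by rewrite size_polyC_leq1.
by rewrite big_seq1 comp_polyC -polyCM -expr2 sqr_sqrtr.
Qed.

(* Subtracting the minimum over [0, oo[ creates a zero there, which is either 0
   or a double one; both 'X and ('X - t0)^2 become para-squares at - 'X^2. *)
Lemma nonneg_para_sos (R : realType) k (p : {poly R}) : (size p <= k)%N ->
  (forall t, 0 <= t -> 0 <= p.[t]) -> para_sos k (p \Po - 'X^2).
Proof.
elim/ltn_ind: k p => k IH p sp p_ge0.
have [/size1_polyC pC|s_gt1] := leqP (size p) 1.
  have [p0|p_neq0] := eqVneq p 0; first by rewrite p0 comp_poly0; exact: para_sos0.
  rewrite pC comp_polyC; apply: (@para_sosW _ 1).
    by move: sp p_neq0; rewrite -size_poly_gt0; lia.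
  by apply: para_sosC; have := p_ge0 0 (lexx _); rewrite horner_coef0.
have lp : 0 < lead_coef p.
  rewrite lt_def lead_coef_eq0 -size_poly_gt0 (ltn_trans _ s_gt1) //=.
  rewrite leNgt; apply/negP => l0.
  have [|T T0 hT] := @lead_coef_gt0_horner _ (- p); first by rewrite lead_coefN oppr_gt0.
  by have := hT T (lexx _); have := p_ge0 T (ltW T0); rewrite hornerN; lra.
(* Beyond T, p exceeds its value at 0, so its minimum over [0, T] is its minimum over [0, oo[. *)
have [T T0 hT] : exists2 T, 0 < T & forall t, T <= t -> 0 < (p - (p.[0])%:P).[t].
  apply: lead_coef_gt0_horner; rewrite lead_coefDl //.
  by rewrite size_polyN (leq_ltn_trans (size_polyC_leq1 _)).
have [t0 /andP[t0_ge0 t0T] t0_min] := horner_min_segment p (ltW T0).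
have {}t0_min t : 0 <= t -> p.[t0] <= p.[t].
  move=> t_ge0; have [tT|Tt] := leP t T; first by apply: t0_min; rewrite t_ge0.
  have := hT t (ltW Tt); have := t0_min 0; rewrite lexx (ltW T0) => /(_ isT).
  by rewrite !hornerE; lra.
pose c := p.[t0]; have c0 : 0 <= c by exact: p_ge0.
have /factor_theorem[q pq] : root (p - c%:P) t0 by rewrite /root !hornerE subrr.
have sq : size q = (size p).-1.
  have spc : size (p - c%:P) = size p.
    by rewrite size_polyDl // size_polyN (leq_ltn_trans (size_polyC_leq1 _)).
  have q0 : q != 0.
    by apply/eqP => q0; move: spc; rewrite pq q0 mul0r size_poly0; lia.
  by rewrite -spc pq size_Mmonic ?monicXsubC // size_XsubC addn2.
have q_val t : p.[t] - c = q.[t] * (t - t0).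
  by have := congr1 (horner^~ t) pq; rewrite !hornerE.
have pE : p = c%:P + q * ('X - t0%:P) by rewrite -pq addrC subrK.
have q_ge t : t0 < t -> 0 <= q.[t].
  move=> t0t; have t_ge0 : 0 <= t by lra.
  have := t0_min t t_ge0; rewrite -subr_ge0 q_val pmulr_lge0 //; lra.
have qt0_ge0 : 0 <= q.[t0].
  by apply: (@horner_ge0_punctured _ _ _ 1) => // x /andP[? _]; exact: q_ge.
(* A minimum at the boundary yields a single factor 'X, which at - 'X^2 becomes the para-square of
   'X. *)
have [t00|t0_neq0] := eqVneq t0 0.
  have sos_q : para_sos k.-1 (q \Po - 'X^2).
    have k1 : (k.-1 < k)%N by lia.
    have sq1 : (size q <= k.-1)%N by rewrite sq; lia.
    apply: (IH _ k1 _ sq1) => t; rewrite le_eqVlt => /orP[/eqP<-|t_gt0].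
      by rewrite -[X in _.[X]]t00.
    by apply: q_ge; rewrite t00.
  have -> : p \Po - 'X^2 = c%:P + 'X * ('X \Po - 'X) * (q \Po - 'X^2).
    rewrite {1}pE t00 comp_polyD comp_polyM comp_polyB !comp_polyC !comp_polyX.
    by rewrite polyC0; ring.
  apply: para_sosD; first by apply: para_sosW (para_sosC c0); lia.
  have -> : k = (1 + k.-1)%N by lia.
  by apply: para_sosM => //; rewrite size_polyX.
have t0_gt0 : 0 < t0 by rewrite lt_def t0_neq0.
(* At an interior minimum q is nonnegative to the right of t0 and nonpositive to the left. Composing
   with t0 - 'X turns the left side into a right one, where [horner_ge0_punctured] applies. *)
have qt0 : q.[t0] = 0.
  apply/eqP; rewrite eq_le qt0_ge0 andbT -oppr_ge0.
  have -> : - q.[t0] = (- q \Po (t0%:P - 'X)).[0] by rewrite horner_comp !hornerE subr0.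
  apply: (@horner_ge0_punctured _ _ _ t0) => // x /andP[x0 xt].
  rewrite add0r in xt; rewrite horner_comp !hornerE oppr_ge0.
  have h : 0 <= t0 - x by lra.
  have := t0_min _ h; rewrite -[p.[t0] <= _]subr_ge0 q_val.
  have -> : t0 - x - t0 = - x by ring.
  by rewrite mulrN oppr_ge0 pmulr_lle0.
have /factor_theorem[r qr] : root q t0 by apply/rootP.
have s_r : (size r <= k - 2)%N.
  have [->|r0] := eqVneq r 0; first by rewrite size_poly0.
  by move: sq; rewrite qr size_Mmonic ?monicXsubC // size_XsubC; lia.
have r_val t : p.[t] - c = r.[t] * (t - t0) ^+ 2.
  by rewrite q_val qr hornerM hornerXsubC -mulrA -expr2.
have r_ge t : 0 <= t -> t != t0 -> 0 <= r.[t].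
  move=> t_ge0 tt0; have := t0_min t t_ge0; rewrite -subr_ge0 r_val pmulr_lge0 //.
  by rewrite exprn_even_gt0 //= subr_eq0.
have sos_r : para_sos (k - 2) (r \Po - 'X^2).
  have k2 : (k - 2 < k)%N by lia.
  apply: (IH _ k2 _ s_r) => t t_ge0; have [->|/r_ge] := eqVneq t t0; last exact.
  apply: (@horner_ge0_punctured _ _ _ 1) => // x /andP[xt0 _].
  by apply: r_ge; [lra|rewrite gt_eqF].
(* At - 'X^2 the factor ('X - t0)^2 becomes ('X^2 + t0)^2, and 'X^2 + t0 is even, hence equal to its
   own reflection. *)
have -> : p \Po - 'X^2 =
    c%:P + ('X^2 + t0%:P) * (('X^2 + t0%:P) \Po - 'X) * (r \Po - 'X^2).
  rewrite {1}pE qr comp_polyD !comp_polyM !comp_polyB !comp_polyD !comp_polyC.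
  by rewrite !comp_polyX rmorphXn /= comp_polyX; ring.
apply: para_sosD; first by apply: para_sosW (para_sosC c0); lia.
have -> : k = (2 + (k - 2))%N by lia.
by apply: para_sosM => //; rewrite size_XnaddC.
Qed.

(** A small multiple of S = 1 + t + ... + t^(n-1) can be subtracted from p while keeping it
    nonnegative; at - 'X^2 each t^i becomes the para-square of 'X^i. *)
Lemma pos_para_sos (R : realType) n (p : {poly R}) : size p = n ->
  (forall t, 0 <= t -> 0 < p.[t]) ->
  exists2 e, 0 < e & exists2 f, para_sos n f &
    p \Po - 'X^2 = e *: (\sum_(i < n) 'X^i * ('X^i \Po - 'X)) + f.
Proof.
move=> sp p_gt0; pose S : {poly R} := \sum_(i < n) 'X^i.
have SE t : S.[t] = \sum_(i < n) t ^+ i.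
  by rewrite horner_sum; apply: eq_bigr => i _; rewrite hornerXn.
have S_le s t : 0 <= s <= t -> S.[s] <= S.[t].
  by move=> /andP[s0 st]; rewrite !SE; apply: ler_sum => i _; rewrite lerXn2r ?nnegrE // (le_trans s0).
have n_gt0 : (0 < n)%N.
  rewrite -sp size_poly_gt0; apply/eqP => p0.
  by have := p_gt0 0 (lexx _); rewrite p0 horner0 ltxx.
have S_gt0 t : 0 <= t -> 0 < S.[t].
  move=> t0; apply: (@lt_le_trans _ _ S.[0]); last by apply: S_le; rewrite lexx.
  rewrite SE (bigD1 (Ordinal n_gt0)) //= expr0 ltr_pwDl // sumr_ge0 // => i _.
  by rewrite exprn_ge0.
have S_coef i : S`_i = (i < n)%N%:R.
  rewrite coef_sum; case: ltnP => [i_n|n_i].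
    rewrite (bigD1 (Ordinal i_n)) //= coefXn eqxx big1 ?addr0 // => j.
    by rewrite coefXn -val_eqE /= eq_sym => /negPf ->.
  by rewrite big1 // => j _; rewrite coefXn gtn_eqF // (leq_trans (ltn_ord j)).
pose l := lead_coef p; have l0 : 0 < l.
  rewrite lt_def lead_coef_eq0 -size_poly_gt0 sp n_gt0 /=.
  rewrite leNgt; apply/negP => l0.
  have [|T T0 hT] := @lead_coef_gt0_horner _ (- p); first by rewrite lead_coefN oppr_gt0.
  by have := hT T (lexx _); have := p_gt0 T (ltW T0); rewrite hornerN; lra.
have [T T0 hT] : exists2 T, 0 < T & forall t, T <= t -> 0 < (p - (l / 2) *: S).[t].
  apply: lead_coef_gt0_horner.
  have c1 : (p - (l / 2) *: S)`_n.-1 = l / 2.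
    rewrite coefB coefZ S_coef ltn_predL n_gt0 mulr1 -sp -lead_coefE -/l; lra.
  suff -> : lead_coef (p - (l / 2) *: S) = l / 2 by lra.
  rewrite lead_coefE; suff -> : size (p - (l / 2) *: S) = n by [].
  apply/eqP; rewrite eqn_leq; apply/andP; split.
    by apply/leq_sizeP => j nj; rewrite coefB coefZ S_coef ltnNge nj mulr0 subr0 nth_default ?sp.
  rewrite -(prednK n_gt0) ltnNge; apply/negP => /leq_sizeP /(_ _ (leqnn _)).
  rewrite c1; lra.
have [t0 /andP[t0_ge0 _] t0_min] := horner_min_segment p (ltW T0).
pose mu := p.[t0]; have mu0 : 0 < mu by exact: p_gt0.
have ST := S_gt0 T (ltW T0).
(* The bound l / 2 keeps p - e S positive beyond T; on [0, T], S is at most S(T), so e S <= mu <=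
   p. *)
pose e := Num.min (l / 2) (mu / S.[T]).
have e0 : 0 < e by rewrite lt_min !divr_gt0.
have el : e <= l / 2 by rewrite ge_min lexx.
have emu : e <= mu / S.[T] by rewrite ge_min lexx orbT.
exists e => //; exists ((p - e *: S) \Po - 'X^2).
  apply: nonneg_para_sos => [|t t_ge0].
    by apply/leq_sizeP => j nj; rewrite coefB coefZ S_coef ltnNge nj mulr0 subr0 nth_default ?sp.
  rewrite !hornerE subr_ge0; have [tT|Tt] := leP t T.
    apply: (@le_trans _ _ mu); last by apply: t0_min; rewrite t_ge0.
    apply: (@le_trans _ _ (e * S.[T])); last by rewrite -ler_pdivlMr.
    by rewrite ler_wpM2l ?(ltW e0) // S_le // t_ge0.
  have := hT t (ltW Tt); rewrite !hornerE subr_gt0 => /ltW; apply: le_trans.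
  by rewrite ler_wpM2r // ltW // S_gt0.
rewrite rmorphB /= linearZ /=.
have -> : S \Po - 'X^2 = \sum_(i < n) 'X^i * ('X^i \Po - 'X).
  rewrite rmorph_sum; apply: eq_bigr => i _ /=.
  by rewrite !rmorphXn /= !comp_polyX -exprMn mulrN expr2.
by rewrite addrC subrK.
Qed.

(** * The Lyapunov equation *)

Section Lyapunov.
Local Open Scope sesquilinear_scope.

Section HermitianLyapunov.
Variable C : numClosedFieldType.

Definition herm_posdef n (Q : 'M[C]_n) : Prop :=
  Q ^t* = Q /\ forall v : 'rV_n, v != 0 -> 0 < (v *m Q *m v ^t*) 0 0.

Lemma adjM m n p (A : 'M[C]_(m, n)) (B : 'M[C]_(n, p)) :
  (A *m B) ^t* = B ^t* *m A ^t*.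
Proof. by rewrite trmx_mul map_mxM. Qed.

Lemma adjD m n (A B : 'M[C]_(m, n)) : (A + B) ^t* = A ^t* + B ^t*.
Proof. by rewrite linearD /= map_mxD. Qed.

Lemma adjN m n (A : 'M[C]_(m, n)) : (- A) ^t* = - A ^t*.
Proof. by rewrite linearN /= map_mxN. Qed.

Lemma adjZ m n (a : C) (A : 'M[C]_(m, n)) : (a *: A) ^t* = a^* *: A ^t*.
Proof. by rewrite linearZ /= map_mxZ. Qed.

Lemma adj_block m1 m2 n1 n2 (A : 'M[C]_(m1, n1)) (B : 'M_(m1, n2))
    (D : 'M_(m2, n1)) (E : 'M_(m2, n2)) :
  (block_mx A B D E) ^t* = block_mx (A ^t*) (D ^t*) (B ^t*) (E ^t*).
Proof. by rewrite tr_block_mx map_block_mx. Qed.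

Lemma adj_row m n1 n2 (A : 'M[C]_(m, n1)) (B : 'M_(m, n2)) :
  (row_mx A B) ^t* = col_mx (A ^t*) (B ^t*).
Proof. by rewrite tr_row_mx map_col_mx. Qed.

Lemma herm_posdef_congr n (X Q : 'M[C]_n) : X \in unitmx ->
  herm_posdef Q -> herm_posdef (X *m Q *m X ^t*).
Proof.
move=> uX [hQ pQ]; split; first by rewrite !adjM trmxCK hQ mulmxA.
move=> v v0; have vX0 : v *m X != 0.
  by apply: contraNneq v0 => vX; rewrite -(mulmxK uX v) vX mul0mx.
by have := pQ _ vX0; rewrite adjM !mulmxA.
Qed.

Lemma mul_adj_ge0 (w : 'M[C]_1) : 0 <= (w *m w ^t*) 0 0.
Proof. by rewrite mxE big_ord1 !mxE mul_conjC_ge0. Qed.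

Lemma mul_adj_gt0 (w : 'M[C]_1) : w != 0 -> 0 < (w *m w ^t*) 0 0.
Proof.
move=> w0; rewrite mxE big_ord1 !mxE mul_conjC_gt0.
by apply: contraNneq w0 => w00; apply/eqP/matrixP => i j; rewrite !ord1 w00 mxE.
Qed.

(** Induction on T = [[t, 0], [c, A]], seeking P = [[p, p y^H], [p y, S + p y y^H]], which is
    positive definite as soon as p > 0 and S is. The upper left block of the equation gives p, the
    lower left one y, and the lower right one is a smaller Lyapunov equation for S. *)
Lemma herm_lyapunov_trig n (T : 'M[C]_n) : is_trig_mx T ->
  (forall i, T i i + (T i i)^* < 0) ->
  forall Q, herm_posdef Q ->
  exists2 P, herm_posdef P & T *m P + P *m T ^t* = - Q.
Proof.
elim/trigsqmx_ind => {n T} [|n x c A trA IH] hd Q [hQ pQ].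
  by exists 0; [split; [rewrite [_ ^t*]flatmx0|move=> v; rewrite [v]thinmx0 eqxx]|rewrite [LHS]flatmx0 [RHS]flatmx0].
pose t := x 0 0; have xE : x = t%:M by rewrite [x]mx11_scalar.
have ht : t + t^* < 0.
  by have := hd (lshift n 0); rewrite block_mxEul.
have hA i : A i i + (A i i)^* < 0.
  by have := hd (rshift 1 i); rewrite block_mxEdr.
move: hQ pQ; rewrite -[Q]submxK.
set q1 := ulsubmx Q; set Q12 := ursubmx Q; set z := dlsubmx Q; set Q' := drsubmx Q.
rewrite adj_block => hQ pQ.
have [hq1 hz hz' hQ'] := eq_block_mx hQ.
pose q := q1 0 0; have q1E : q1 = q%:M by rewrite [q1]mx11_scalar.
have q_gt0 : 0 < q.
  have /pQ : row_mx (1%:M : 'M[C]_1) (0 : 'rV_n) != 0.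
    by rewrite row_mx_eq0 negb_and oner_eq0.
  rewrite mul_row_block adj_row mul_row_col !mul0mx !mul1mx !addr0.
  by rewrite linear0 map_mx0 mulmx0 addr0 trmx1 map_mx1 mulmx1.
pose p := - q / (t + t^*); have p_gt0 : 0 < p.
  by rewrite /p mulNr -mulrN pmulr_rgt0 // -invrN invr_gt0 oppr_gt0.
have p_real : p^* = p by apply/CrealP/gtr0_real.
(* The diagonal entries of A and t all have negative real part, so no diagonal entry of this
   triangular matrix vanishes. *)
have uB : A + (t^*)%:M \in unitmx.
  rewrite unitmxE unitfE det_trig; last first.
    apply/is_trig_mxP => i j ij; rewrite !mxE (is_trig_mxP trA) // add0r.
    by rewrite -val_eqE /= ltn_eqF.
  apply/prodf_neq0 => i _; rewrite !mxE eqxx mulr1n; apply: contraTneq (hA i) => /eqP.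
  rewrite addr_eq0 => /eqP ->; rewrite rmorphN /= conjCK -opprD oppr_lt0.
  by rewrite addrC lt_gtF.
pose y := invmx (A + (t^*)%:M) *m (- p^-1 *: z - c).
have yE : p *: (c + A *m y) = - z - (p * t^*) *: y.
  have : (A + (t^*)%:M) *m y = - p^-1 *: z - c by rewrite mulKVmx.
  rewrite mulmxDl mul_scalar_mx => e.
  have -> : A *m y = - p^-1 *: z - c - t^* *: y by rewrite -e addrK.
  rewrite !addrA [c + _]addrC addrK scalerDr scalerN scalerA.
  by rewrite mulrN mulfV ?gt_eqF // scaleN1r scalerA.
(* The right-hand side left for S. Its form at v is that of Q at the row (- v y, v), hence its
   definiteness. *)
clearbody y; pose Qs := Q' - z *m y ^t* - y *m z ^t* + q *: (y *m y ^t*).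
have q_real : q^* = q by apply/CrealP/gtr0_real.
have Qs_pd : herm_posdef Qs.
  split.
    rewrite /Qs !adjD !adjN adjZ !adjM !trmxCK hQ' q_real.
    by rewrite -!addrA; congr (_ + _); rewrite addrCA.
  move=> v v0; have /pQ : row_mx (- (v *m y)) v != 0.
    by rewrite row_mx_eq0 negb_and v0 orbT.
  rewrite mul_row_block adj_row mul_row_col q1E mul_mx_scalar -hz.
  move=> h; suff <- : (q *: - (v *m y) + v *m z) *m (- (v *m y)) ^t* +
      (- (v *m y) *m z ^t* + v *m Q') *m v ^t* = v *m Qs *m v ^t* by [].
  rewrite {h} /Qs !mulmxDr !mulmxDl !mulmxN !mulNmx !adjN adjM.
  rewrite -!scalemxAr -!scalemxAl !mulmxN !mulNmx !scalerN !opprK !mulmxA.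
  by rewrite [LHS](AC (2*2) (4*2*3*1)).
have [S [hS pS] eS] := IH hA Qs Qs_pd.
exists (block_mx p%:M (p *: y ^t*) (p *: y) (S + p *: (y *m y ^t*))).
  split.
    rewrite adj_block !adjZ adjD adjZ adjM !trmxCK p_real hS.
    by rewrite tr_scalar_mx map_scalar_mx /= p_real.
  move=> v; rewrite -[v]hsubmxK; set a := lsubmx v; set u := rsubmx v => v0.
  rewrite mul_row_block adj_row mul_row_col.
  have -> : (a *m p%:M + u *m (p *: y)) *m a ^t* +
     (a *m (p *: y ^t*) + u *m (S + p *: (y *m y ^t*))) *m u ^t* =
     p *: ((a + u *m y) *m (a + u *m y) ^t*) + u *m S *m u ^t*.
    rewrite mul_mx_scalar adjD adjM !mulmxDr !mulmxDl -!scalemxAr -!scalemxAl.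
    by rewrite !scalerDr !mulmxA [LHS](AC (2*(1*2)) ((1*2)*(3*5)*4)).
  rewrite [X in 0 < X]mxE [X in 0 < X + _]mxE; have [u0|u0] := eqVneq u 0.
    rewrite u0 !mul0mx addr0 [X in _ + X]mxE addr0 pmulr_rgt0 //; apply: mul_adj_gt0.
    by move: v0; rewrite row_mx_eq0 u0 eqxx andbT.
  by apply: ltr_wpDl; [apply: mulr_ge0 (ltW p_gt0) (mul_adj_ge0 _)|exact: pS].
rewrite adj_block !mulmx_block opp_block_mx add_block_mx.
rewrite linear0 map_mx0 !mul0mx !mulmx0 !addr0.
have e21 : c *m p%:M + A *m (p *: y) + (p *: y) *m x ^t* = - z.
  rewrite xE tr_scalar_mx map_scalar_mx !mul_mx_scalar -scalemxAr -scalerDr yE.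
  by rewrite scalerA mulrC subrK.
have e12 := congr1 (fun M : 'M[C]_(n, 1) => M ^t*) e21.
have pt : p * (t + t^*) = - q by rewrite /p divfK // lt_eqF.
congr block_mx => //.
- rewrite xE q1E tr_scalar_mx map_scalar_mx /= -!scalar_mxM -raddfD /= -raddfN /=.
  by rewrite [t * p]mulrC -mulrDr pt.
- move: e12; rewrite !adjD !adjM adjN !adjZ trmxCK p_real hz => <-.
  rewrite tr_scalar_mx map_scalar_mx /= p_real.
  by rewrite [LHS](AC (1*2) (2*3*1)).
have -> : c *m (p *: y ^t*) + A *m (S + p *: (y *m y ^t*)) +
    (p *: y *m c ^t* + (S + p *: (y *m y ^t*)) *m A ^t*) =
    (A *m S + S *m A ^t*) +
    ((p *: (c + A *m y)) *m y ^t* + y *m (p *: (c + A *m y)) ^t*).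
  rewrite adjZ adjD adjM p_real !mulmxDr !mulmxDl -!scalemxAr -!scalemxAl.
  rewrite !mulmxDr !mulmxDl !scalerDr !mulmxA.
  by rewrite [LHS](AC ((1*2)*(1*2)) ((2*5)*((1*3)*(4*6)))).
rewrite eS yE /Qs adjD !adjN adjZ rmorphM /= conjCK p_real.
rewrite !mulmxDr !mulmxDl !mulmxN !mulNmx -!scalemxAr -!scalemxAl.
have -> : q = - (p * (t + t^*)) by rewrite pt opprK.
rewrite mulrDr scaleNr scalerDl !opprD !opprK.
rewrite [LHS](AC (((1*1)*1*2)*((1*1)*(1*1))) (1*(2*6)*(3*8)*(4*9)*(5*7))).
by rewrite /= !subrr !addr0.
Qed.

(** Schur's unitary triangularization: a unitary congruence transports Q to the triangular problem
    and its solution back. *)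
Lemma herm_lyapunov n (A : 'M[C]_n) :
  (forall s, \det (s%:M - A) = 0 -> s + s^* < 0) ->
  forall Q, herm_posdef Q ->
  exists2 P, herm_posdef P & A *m P + P *m A ^t* = - Q.
Proof.
case: n A => [|n] A hA Q pQ.
  by exists Q => //; rewrite [LHS]flatmx0 [RHS]flatmx0.
have [U unU] := Schur A (ltn0Sn n).
rewrite /similar_to conjymx // => trT; set T := U *m A *m U ^t* in trT.
have UU : U *m U ^t* = 1%:M by apply/unitarymxP.
have U'U : U ^t* *m U = 1%:M by apply: mulmx1C.
have uU : U \in unitmx by exact: unitarymx_unit.
have uU' : U ^t* \in unitmx by apply: unitarymx_unit; rewrite trmxC_unitary.
have hT i : T i i + (T i i)^* < 0.
  apply: hA; set s := T i i.
  have : \det (s%:M - T) = 0.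
    rewrite det_trig; last first.
      apply/is_trig_mxP => k j kj; rewrite mxE [_%:M _ _]mxE [(- T) _ _]mxE.
      by rewrite (is_trig_mxP trT) // subr0 -val_eqE /= ltn_eqF.
    by rewrite (bigD1 i) //= 2!mxE eqxx mulr1n [(- T) i i]mxE subrr mul0r.
  have -> : s%:M - T = U *m (s%:M - A) *m U ^t*.
    by rewrite mulmxBr mulmxBl mul_mx_scalar -scalemxAl UU scalemx1.
  rewrite !det_mulmx => /eqP; rewrite !mulf_eq0 => /orP[/orP[|/eqP//]|].
    by move: uU; rewrite unitmxE unitfE => /negPf ->.
  by move: uU'; rewrite unitmxE unitfE => /negPf ->.
have [P pP eP] := herm_lyapunov_trig trT hT (herm_posdef_congr uU pQ).
exists (U ^t* *m P *m U).
  by have := herm_posdef_congr uU' pP; rewrite trmxCK.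
have -> : A *m (U ^t* *m P *m U) + U ^t* *m P *m U *m A ^t* =
    U ^t* *m (T *m P + P *m T ^t*) *m U.
  rewrite /T !adjM trmxCK mulmxDr mulmxDl !mulmxA U'U mul1mx.
  by congr (_ + _); rewrite -[RHS]mulmxA U'U mulmx1.
rewrite eP mulmxN mulNmx; congr (- _).
by rewrite !mulmxA U'U mul1mx -mulmxA U'U mulmx1.
Qed.

End HermitianLyapunov.

Lemma trmx11 (F : pzSemiRingType) (M : 'M[F]_1) : M^T = M.
Proof. by rewrite [M]mx11_scalar tr_scalar_mx. Qed.

Lemma mx00B (F : pzRingType) (X Y : 'M[F]_1) : (X - Y) 0 0 = X 0 0 - Y 0 0.
Proof. by rewrite !mxE. Qed.

Lemma mx00Z (F : pzRingType) (a : F) (X : 'M[F]_1) : (a *: X) 0 0 = a * X 0 0.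
Proof. by rewrite mxE. Qed.

Definition posdef (F : numFieldType) n (Q : 'M[F]_n) : Prop :=
  Q^T = Q /\ forall v : 'cV_n, v != 0 -> 0 < (v^T *m Q *m v) 0 0.

(** The data are real, so the entrywise real part of a Hermitian solution solves the same equation,
    and it stays symmetric and definite on real vectors. The transpose in [toC A^T] reconciles the
    form A P + P A^H with A^T P + P A. *)
Lemma lyapunov_posdef (F : rcfType) n (A : 'M[F]_n) :
  (forall s : F[i], \det (s%:M - toC A) = 0 -> complex.Re s < 0) ->
  forall Q, posdef Q ->
  exists2 P, posdef P & A^T *m P + P *m A = - Q.
Proof.
move=> hA Q [sQ pQ].
have conjE (z : F[i]) : Num.conj z = conjc z by [].
have ReD (x y : F[i]) : complex.Re (x + y) = complex.Re x + complex.Re y by case: x; case: y.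
have Re0 : complex.Re (0 : F[i]) = 0 by [].
have Re_sum I (r : seq I) (p : pred I) (f : I -> F[i]) :
    complex.Re (\sum_(i <- r | p i) f i) = \sum_(i <- r | p i) complex.Re (f i).
  by apply: (big_morph _ ReD Re0).
have ReM (x : F) (z : F[i]) : complex.Re (x%:C * z)%C = x * complex.Re z.
  by case: z => a b; rewrite /= mul0r subr0.
have ReMl m k l (X : 'M[F]_(m, k)) (Z : 'M[F[i]]_(k, l)) :
    map_mx (@complex.Re F) (toC X *m Z) = X *m map_mx (@complex.Re F) Z.
  by apply/matrixP => i j; rewrite !mxE Re_sum; apply: eq_bigr => u _; rewrite !mxE ReM.
have ReMr m k l (Z : 'M[F[i]]_(m, k)) (X : 'M[F]_(k, l)) :
    map_mx (@complex.Re F) (Z *m toC X) = map_mx (@complex.Re F) Z *m X.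
  apply/matrixP => i j; rewrite !mxE Re_sum; apply: eq_bigr => u _.
  by rewrite !mxE mulrC ReM mulrC.
have Re_mxD m k (Y Z : 'M[F[i]]_(m, k)) : map_mx (@complex.Re F) (Y + Z) =
    map_mx (@complex.Re F) Y + map_mx (@complex.Re F) Z.
  by apply/matrixP => i j; rewrite !mxE ReD.
have conjT m k (X : 'M[F]_(m, k)) : (toC X) ^t* = toC X^T.
  by apply/matrixP => i j; rewrite !mxE conjE conjc_real.
have [||P [hP pP] eP] := @herm_lyapunov F[i] n (toC A^T) _ (toC Q).
- move=> s; rewrite -det_tr linearB /= tr_scalar_mx map_trmx trmxK => /hA.
  by case: s => a b /= a0; rewrite conjE ltcE /= subrr eqxx; lra.
- split.
    apply/matrixP => i j; rewrite !mxE conjE conjc_real.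
    by rewrite -[in LHS]sQ mxE.
  (* Splitting v into real and imaginary parts, the cross terms cancel by the symmetry of Q. *)
  move=> v v0; pose a := (map_mx (@complex.Re F) v)^T; pose b := (map_mx (@complex.Im F) v)^T.
  have vE : v = toC a^T + 'i%C *: toC b^T.
    apply/matrixP => i j; rewrite !mxE; case: (v i j) => x y /=.
    by simpc.
  have vE' : v ^t* = toC a - 'i%C *: toC b.
    apply/matrixP => i j; rewrite !mxE conjE; case: (v j i) => x y /=.
    by simpc.
  clearbody a b; have eba : b^T *m Q *m a = a^T *m Q *m b.
    by rewrite -[LHS]trmx11 !trmx_mul trmxK sQ mulmxA.
  have -> : v *m toC Q *m v ^t* = toC (a^T *m Q *m a + b^T *m Q *m b).
    rewrite vE' {1}vE !mulmxDl !mulmxDr !mulmxN -!scalemxAl -!scalemxAr.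
    rewrite -!map_mxM eba map_mxD scalerA.
    have -> : 'i%C * 'i%C = -1 :> F[i].
      by apply/eqP; rewrite eq_complex /=; apply/andP; split; apply/eqP; ring.
    by rewrite scaleN1r opprK addrA subrK.
  rewrite mxE ltcR mxE.
  have qf_ge0 (u : 'cV_n) : 0 <= (u^T *m Q *m u) 0 0.
    by have [->|u0] := eqVneq u 0; [rewrite mulmx0 mxE|exact: ltW (pQ _ u0)].
  have [a0|a0] := eqVneq a 0; last first.
    by apply: ltr_pwDl; [exact: pQ|exact: qf_ge0].
  apply: ltr_wpDl => //; apply: pQ; apply: contraNneq v0 => b0.
  by rewrite vE a0 b0 trmx0 !map_mx0 scaler0 addr0.
exists (map_mx (@complex.Re F) P).
  split.
    apply/matrixP => i j; rewrite !mxE -[in RHS]hP !mxE conjE.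
    by case: (P j i).
  move=> v v0; have /pP : toC v^T != 0.
    apply: contraNneq v0 => /matrixP e; apply/eqP/matrixP => i j.
    by have := e j i; rewrite !mxE => /(congr1 (@complex.Re F)).
  rewrite ltcE conjT trmxK => /andP[_] /=; congr (_ < _).
  transitivity (map_mx (@complex.Re F) (toC v^T *m P *m toC v) 0 0).
    by rewrite [RHS]mxE.
  by rewrite ReMr ReMl.
have := congr1 (map_mx (@complex.Re F)) eP; rewrite conjT trmxK.
rewrite Re_mxD ReMl ReMr => ->.
by apply/matrixP => i j; rewrite !mxE.
Qed.

End Lyapunov.

(** * The strict positive real lemma *)

Lemma horner_char_poly (F : comNzRingType) n (A : 'M[F]_n) s :
  (char_poly A).[s] = \det (s%:M - A).
Proof.
rewrite -horner_evalE /char_poly -det_map_mx; congr (\det _).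
apply/matrixP => i j; rewrite !mxE /= /horner_eval hornerD hornerN hornerC hornerMn hornerX.
by [].
Qed.

Section ResolventPolynomial.
Variables (F : fieldType) (n : nat) (A : 'M[F]_n) (b : 'cV[F]_n).

(* Locked to keep mxE from expanding the adjugate. *)
Definition res_poly : 'cV[{poly F}]_n :=
  locked (\adj (char_poly_mx A) *m map_mx polyC b).

Definition res_coef k : 'cV[F]_n := \col_i (res_poly i 0)`_k.

Definition res_eval s : 'cV[F]_n := \col_i (res_poly i 0).[s].

Lemma char_poly_mx_res_poly :
  char_poly_mx A *m res_poly = char_poly A *: map_mx polyC b.
Proof. by rewrite /res_poly -lock mulmxA mul_mx_adj mul_scalar_mx. Qed.

Lemma res_polyE i : 'X * res_poly i 0 =
  \sum_j A i j *: res_poly j 0 + (b i 0) *: char_poly A.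
Proof.
have /matrixP/(_ i 0) := char_poly_mx_res_poly.
rewrite /char_poly_mx mulmxBl mul_scalar_mx !mxE => /eqP.
rewrite subr_eq addrC => /eqP ->; congr (_ + _).
  by apply: eq_bigr => j _; rewrite mxE mul_polyC.
by rewrite mulrC mul_polyC.
Qed.

(** The coefficient of 'X^(k+1) in 'X y = A y + a b: the Faddeev-LeVerrier recursion applied to
    b. *)
Lemma res_coefS k :
  res_coef k = A *m res_coef k.+1 + (char_poly A)`_k.+1 *: b.
Proof.
apply/matrixP => i j; rewrite ord1 !mxE.
have := congr1 (fun p : {poly F} => p`_k.+1) (res_polyE i).
rewrite coefXM /= => ->; rewrite coefD coefZ coef_sum mulrC.
by congr (_ + _); apply: eq_bigr => l _; rewrite coefZ mxE.
Qed.

Lemma res_coef0 : A *m res_coef 0 = - (char_poly A)`_0 *: b.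
Proof.
apply/matrixP => i j; rewrite ord1 !mxE.
have := congr1 (fun p : {poly F} => p`_0) (res_polyE i).
rewrite coefXM /= coefD coefZ coef_sum => /eqP.
rewrite eq_sym addr_eq0 => /eqP e; rewrite mulNr mulrC -e.
by apply: eq_bigr => l _; rewrite coefZ mxE.
Qed.

Lemma res_evalE s : s *: res_eval s = A *m res_eval s + (char_poly A).[s] *: b.
Proof.
apply/matrixP => i j; rewrite ord1 !mxE.
have := congr1 (horner^~ s) (res_polyE i).
rewrite hornerM hornerX hornerD hornerZ horner_sum mulrC => ->.
rewrite [b i 0 * _]mulrC; congr (_ + _).
by apply: eq_bigr => l _; rewrite hornerZ mxE.
Qed.

(** From index n on the recursion reads y_k = A y_(k+1), because a has degree n; since y_k vanishes
    for large k, it vanishes for all k >= n. *)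
Lemma size_res_poly i : (size (res_poly i 0)%R <= n)%N.
Proof.
have step k m : (n <= k)%N -> res_coef k = iter m (mulmx A) (res_coef (k + m)).
  elim: m k => [|m IH] k nk; first by rewrite addn0.
  rewrite iterS addnS -addSn -IH; last by rewrite ltnW.
  rewrite res_coefS [X in X *: b]nth_default ?scale0r ?addr0 //.
  by rewrite size_char_poly.
pose N := (\max_i size (res_poly i ord0))%N.
have big0 k : (N <= k)%N -> res_coef k = 0.
  move=> Nk; apply/matrixP => l j; rewrite !mxE nth_default //.
  by apply: leq_trans Nk; exact: (leq_bigmax l).
apply/leq_sizeP => k nk.
have : res_coef k = 0.
  rewrite (step k N nk) big0 ?leq_addl //.
  by elim: N {big0} => //= m ->; rewrite mulmx0.
by move=> /matrixP/(_ i 0); rewrite !mxE.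
Qed.

Lemma res_coef_ge k : (n <= k)%N -> res_coef k = 0.
Proof.
move=> nk; apply/matrixP => i j; rewrite !mxE nth_default //.
exact: leq_trans (size_res_poly i) nk.
Qed.

Lemma res_coef_last : (0 < n)%N -> res_coef n.-1 = b.
Proof.
move=> n0; rewrite res_coefS prednK // res_coef_ge // mulmx0 add0r.
have := char_poly_monic A; rewrite monicE lead_coefE size_char_poly /= => /eqP ->.
by rewrite scale1r.
Qed.

Hypothesis ctrl : forall q : 'rV[F]_n, (forall k, q *m (A ^+ k *m b) = 0) -> q = 0.

Definition res_mx : 'M[F]_n := \matrix_(i, k) res_coef k i 0.

Lemma mul_res_mx (q : 'rV[F]_n) (k : 'I_n) : (q *m res_mx) 0 k = (q *m res_coef k) 0 0.
Proof. by rewrite !mxE; apply: eq_bigr => j _; rewrite mxE. Qed.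

(** A row vector killing all coefficient vectors kills b, the last of them, and by the recursion
    every A^k b; controllability makes it zero. *)
Lemma res_mx_unit : res_mx \in unitmx.
Proof.
rewrite unitmxE unitfE; apply/negP => /det0P[q q0 /matrixP qW].
case: (posnP n) => [n0|n_gt0].
  by move: q0; rewrite (_ : q = 0) ?eqxx //; apply/matrixP => i j; have := ltn_ord j; rewrite {2}n0.
have qY k : q *m res_coef k = 0.
  have [kn|nk] := ltnP k n; last by rewrite res_coef_ge // mulmx0.
  apply/matrixP => i j; rewrite !ord1.
  by rewrite -(mul_res_mx q (Ordinal kn)) qW !mxE.
suff H k : forall j, q *m (A ^+ k *m res_coef j) = 0.
  by move: q0; rewrite (ctrl (q := q)) ?eqxx // => k; rewrite -(res_coef_last n_gt0).
elim: k => [|k IH] j; first by rewrite expr0 -[1]/(1%:M) mul1mx.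
have bk : q *m (A ^+ k *m b) = 0 by rewrite -(res_coef_last n_gt0).
rewrite exprSr -mulmxA; case: j => [|j].
  by rewrite res_coef0 -!scalemxAr bk scaler0.
have -> : A *m res_coef j.+1 = res_coef j - (char_poly A)`_j.+1 *: b.
  by rewrite [res_coef j]res_coefS addrK.
by rewrite !mulmxBr IH -!scalemxAr bk scaler0 subr0.
Qed.

Definition res_dual (p : {poly F}) : 'rV[F]_n := poly_rV p *m invmx res_mx.

Lemma res_evalM (q : 'rV[F]_n) s : (q *m res_eval s) 0 0 = (rVpoly (q *m res_mx)).[s].
Proof.
rewrite (@horner_coef_wide _ n); last by rewrite size_poly.
under eq_bigr do rewrite coef_rVpoly_ord mul_res_mx mxE mulr_suml.
rewrite exchange_big mxE; apply: eq_bigr => i _ /=.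
rewrite mxE (horner_coef_wide _ (size_res_poly i)) mulr_sumr.
by apply: eq_bigr => k _; rewrite mxE mulrA.
Qed.

Lemma res_dualP (p : {poly F}) s : (size p <= n)%N -> (res_dual p *m res_eval s) 0 0 = p.[s].
Proof. by move=> sp; rewrite res_evalM /res_dual mulmxKV ?res_mx_unit // poly_rV_K. Qed.

End ResolventPolynomial.

(** Identities derived through the resolvent hold only off finitely many points. Here p q vanishes
    at more natural numbers than its degree allows. *)
Lemma poly_eq0_off_roots (F : numFieldType) (p q : {poly F}) : q != 0 ->
  (forall s, q.[s] != 0 -> p.[s] = 0) -> p = 0.
Proof.
move=> q0 pq; apply/eqP; have : p * q = 0; last first.
  by move/eqP; rewrite mulf_eq0 (negPf q0) orbF.
pose rs := [seq i%:R : F | i <- iota 0 (size (p * q))].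
apply: (@roots_geq_poly_eq0 _ _ rs); last by rewrite size_map size_iota.
- apply/allP => s _; apply/rootP; rewrite hornerM.
  by have [->|/pq ->] := eqVneq q.[s] 0; rewrite ?mulr0 ?mul0r.
- rewrite map_inj_uniq ?iota_uniq // => i j /eqP; rewrite eqr_nat => /eqP //.
Qed.

(** A common root s would put both s and - s in the open left half-plane. *)
Lemma hurwitz_coprimep (F : rcfType) (a : {poly F}) :
  (forall s : F[i], root (map_poly (real_complex F) a) s -> complex.Re s < 0) ->
  coprimep a (a \Po - 'X).
Proof.
move=> ha; rewrite -(coprimep_map (real_complex F)).
apply: Pdiv.ClosedField.root_coprimep => s rs; apply/negP => rs'.
have := ha _ rs; suff /ha : root (map_poly (real_complex F) a) (- s).
  by case: s {rs rs'} => x y /=; lra.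
move: rs'; rewrite map_comp_poly /root horner_comp.
by rewrite rmorphN /= map_polyX hornerN hornerX.
Qed.

Section PositiveReal.
Variables (R : realType) (n : nat) (A : 'M[R]_n) (b c : 'cV[R]_n) (d : {poly R}).
Hypothesis ctrl : forall q : 'rV[R]_n, (forall k, q *m (A ^+ k *m b) = 0) -> q = 0.
Hypothesis stab : forall s : R[i], \det (s%:M - toC A) = 0 -> complex.Re s < 0.
Let a := char_poly A.
Let y := res_eval A b.
Hypothesis size_d : size d = n.
Hypothesis d_gt0 : forall t, 0 <= t -> 0 < d.[t].
Hypothesis d_real_part : forall s, a.[s] != 0 -> a.[- s] != 0 -> s != 0 ->
  a.[- s] * (c^T *m y s) 0 0 + a.[s] * (c^T *m y (- s)) 0 0 = d.[- s ^+ 2].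

(** If the row r represents p, then p(s) p(-s) = y(-s)^T r^T r y(s); the matrices r^T r of all the
    para-squares add up to Q. *)
Lemma gram_of_real_part : exists2 Q, posdef Q &
  forall s, ((y (- s))^T *m Q *m y s) 0 0 = d.[- s ^+ 2].
Proof.
have [e e0 [_ [ps /allP hps ->] dE]] := pos_para_sos size_d d_gt0.
pose r := res_dual A b.
have rP (p : {poly R}) s : (size p <= n)%N -> (r p *m y s) 0 0 = p.[s] by move=> ?; exact: res_dualP.
pose Q := e *: (\sum_(i < n) (r 'X^i)^T *m r 'X^i) + \sum_(p <- ps) (r p)^T *m r p.
have sqE p (u v : 'cV_n) : (u^T *m ((r p)^T *m r p) *m v) 0 0 =
    (r p *m u) 0 0 * (r p *m v) 0 0.
  by rewrite mulmxA -mulmxA -trmx_mul mxE big_ord1 mxE.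
have QE (u v : 'cV_n) : (u^T *m Q *m v) 0 0 =
    e * (\sum_(i < n) (r 'X^i *m u) 0 0 * (r 'X^i *m v) 0 0) +
    \sum_(p <- ps) (r p *m u) 0 0 * (r p *m v) 0 0.
  rewrite mulmxDr mulmxDl -scalemxAr -scalemxAl !mulmx_sumr !mulmx_suml.
  rewrite mxE [X in X + _]mxE !summxE.
  by congr (e * _ + _); apply: eq_bigr => p _; rewrite sqE.
exists Q.
  split.
    rewrite linearD linearZ /= !linear_sum /=.
    rewrite /Q scaler_sumr; congr (_ + _); apply: eq_bigr => p _; by rewrite trmx_mul trmxK.
  move=> v v0; rewrite QE ltr_pwDl //; last first.
    by apply: sumr_ge0 => p _; rewrite -expr2 sqr_ge0.
  rewrite pmulr_rgt0 // lt_def sumr_ge0 ?andbT; last by move=> i _; rewrite -expr2 sqr_ge0.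
  apply: contra v0; rewrite psumr_eq0; last by move=> i _; rewrite -expr2 sqr_ge0.
  move=> /allP h; have h' (i : 'I_n) : (r 'X^i *m v) 0 0 = 0.
    by have /implyP/(_ isT) := h i (mem_index_enum _); rewrite -expr2 sqrf_eq0 => /eqP.
  (* The rows representing the monomials are those of [invmx (res_mx A b)], so only v = 0 is killed
     by all of them. *)
  have uW := res_mx_unit ctrl.
  suff : invmx (res_mx A b) *m v = 0.
    by move=> e1; rewrite -(mulKVmx uW v) e1 mulmx0.
  apply/matrixP => i j; rewrite ord1 [RHS]mxE -(h' i) /r /res_dual.
  rewrite -mulmxA; suff -> : poly_rV 'X^i = delta_mx 0 i :> 'rV[R]_n.
    by rewrite -rowE [RHS]mxE.
  by apply/matrixP => k l; rewrite ord1 !mxE coefXn eqxx /= -val_eqE.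
move=> s; rewrite QE; have := congr1 (horner^~ s) dE.
rewrite horner_comp hornerN hornerXn => ->.
rewrite hornerD hornerZ !horner_sum; congr (e * _ + _).
  apply: eq_bigr => i _; rewrite !rP ?size_polyXn // hornerM horner_comp.
  by rewrite !hornerE mulrC.
rewrite !big_seq; apply: eq_bigr => p /hps sp.
by rewrite !rP // hornerM horner_comp !hornerE mulrC.
Qed.

(* P solves the Lyapunov equation of the Gram matrix Q; E, the numerator of the
   transfer function of c - P b, then satisfies E(s) a(-s) + E(-s) a(s) = 0, so
   the Hurwitz polynomial a divides E and E = 0 by degree. *)
Lemma kyp_strict : exists P Q, [/\ posdef P, posdef Q,
  A^T *m P + P *m A = - Q & P *m b = c].
Proof.
have [Q pQ QE] := gram_of_real_part.
have [P pP PE] := lyapunov_posdef stab pQ; exists P, Q; split => //.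
have [sP _] := pP.
pose f : 'cV_n := c - P *m b; suff f0 : f = 0 by apply/esym/eqP; rewrite -subr_eq0 -/f f0.
pose E : {poly R} := rVpoly (f^T *m res_mx A b).
have Es s : E.[s] = (f^T *m y s) 0 0 by rewrite /E -res_evalM.
have a0 : a != 0 by rewrite -size_poly_gt0 size_char_poly.
have aN0 : a \Po - 'X != 0.
  by rewrite -size_poly_gt0 size_comp_poly2 ?size_polyN ?size_polyX // size_char_poly.
have hs s : s *: y s = A *m y s + a.[s] *: b by exact: res_evalE.
(* In y(-s)^T (A^T P + P A) y(s), replacing A y(u) by u y(u) - a(u) b cancels the terms in s y(-s)^T
   P y(s) and leaves those in P b. *)
have idP s : a.[- s] * ((P *m b)^T *m y s) 0 0 + a.[s] * ((P *m b)^T *m y (- s)) 0 0 =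
    d.[- s ^+ 2].
  have Ay u : A *m y u = u *: y u - a.[u] *: b by rewrite hs addrK.
  have yA u : (y u)^T *m A^T = u *: (y u)^T - a.[u] *: b^T.
    by rewrite -trmx_mul Ay linearB !linearZ.
  rewrite -QE -[Q]opprK -PE !trmx_mul sP.
  rewrite mulmxN mulNmx mulmxDr mulmxDl -!mulmxA Ay !mulmxA yA.
  rewrite !mulmxBr !mulmxBl -!scalemxAl -!scalemxAr.
  have -> : b^T *m P *m y (- s) = (y (- s))^T *m P *m b.
    by rewrite -[LHS]trmx11 !trmx_mul trmxK sP mulmxA.
  rewrite !mxE; ring.
have E_par : E * (a \Po - 'X) + (E \Po - 'X) * a = 0.
  apply: (@poly_eq0_off_roots _ _ ('X * a * (a \Po - 'X))).
    by rewrite !mulf_neq0 ?polyX_eq0.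
  move=> s; rewrite !hornerM !mulf_eq0 !negb_or -andbA horner_comp hornerN !hornerX.
  move=> /and3P[s0 as0 aNs0].
  rewrite hornerD !hornerM !horner_comp hornerN hornerX !Es /f.
  rewrite linearB /= !mulmxBl; have := idP s; rewrite -(d_real_part as0 aNs0 s0).
  by rewrite !mx00B; lra.
have dvdE : a %| E.
  have : a %| E * (a \Po - 'X).
    have -> : E * (a \Po - 'X) = - ((E \Po - 'X) * a) by apply/eqP; rewrite -addr_eq0 E_par.
    by rewrite -mulNr dvdp_mull.
  rewrite Gauss_dvdpl // hurwitz_coprimep // => s rs; apply: stab.
  by move: rs; rewrite map_char_poly => /rootP; rewrite horner_char_poly.
have E0 : E = 0.
  apply/eqP; apply: contraTT dvdE => E0; rewrite gtNdvdp //.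
  by rewrite size_char_poly ltnS size_poly.
apply: trmx_inj; rewrite trmx0 -(mulmxK (res_mx_unit ctrl) f^T).
have -> : f^T *m res_mx A b = 0 by apply: (can_inj rVpolyK); rewrite -/E E0 linear0.
by rewrite mul0mx.
Qed.
End PositiveReal.

(** * Rank-one perturbations *)

(** Weinstein-Aronszajn identity, from two block-triangular factorizations of one matrix. *)
Lemma det_1DmulC (F : comNzRingType) m n (u : 'M[F]_(m, n)) (v : 'M[F]_(n, m)) :
  \det (1%:M + u *m v) = \det (1%:M + v *m u).
Proof.
have e1 : block_mx 1%:M (- u) v 1%:M =
    block_mx 1%:M 0 v 1%:M *m block_mx 1%:M (- u) 0 (1%:M + v *m u).
  by rewrite mulmx_block !(mul1mx, mul0mx, mulmx1, mulmx0, addr0, add0r, mulmxN) addrCA addNr addr0.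
have e2 : block_mx 1%:M (- u) v 1%:M =
    block_mx (1%:M + u *m v) (- u) 0 1%:M *m block_mx 1%:M 0 v 1%:M.
  by rewrite mulmx_block !(mul1mx, mul0mx, mulmx1, mulmx0, addr0, add0r, mulNmx) addrK.
have := congr1 determinant e1; rewrite e2 !det_mulmx !det_ublock !det_lblock !det1.
by rewrite !(mul1r, mulr1).
Qed.

Lemma det_1DZ (F : fieldType) n (B : 'M[F]_n) t : t != 0 ->
  \det (1%:M + t *: B) = (- t) ^+ n * (char_poly B).[- t^-1].
Proof.
move=> t0; rewrite horner_char_poly -detZ scalerBr -scaleNr opprK.
by rewrite -[in RHS]scalemx1 scalerA mulrNN mulfV // scale1r.
Qed.

Section RankOnePerturbation.
Variables (R : realType) (n : nat) (M : 'M[R]_n) (g h : 'cV[R]_n).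
Hypothesis uM : M \in unitmx.
Let A := invmx M.
Let N := M - g *m h^T.
Let chi := char_poly (M *m N).
Hypothesis stab : forall s : R[i], \det (s%:M - toC A) = 0 -> complex.Re s < 0.
Hypothesis ctrl : forall q : 'rV[R]_n,
  (forall k, (k < n)%N -> q *m (M ^+ k *m g) = 0) -> q = 0.
Hypothesis chi_neg : forall l, l < 0 -> chi.[l] != 0.
Hypothesis chi_0 : chi`_0 = 0.
Hypothesis chi_1 : chi`_1 != 0.

Lemma inv_unitmx : A \in unitmx. Proof. by rewrite unitmx_inv. Qed.

(** chi(0) = 0 makes 1 - A g h^T singular, and the determinant of that matrix is 1 - h^T A g. *)
Lemma gain_eq1 : h^T *m A *m g = 1%:M.
Proof.
have : \det (1%:M - A *m g *m h^T) = 0.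
  have : \det (M *m (M *m (1%:M - A *m g *m h^T))) = 0.
    rewrite mulmxBr mulmx1 !mulmxA mulmxV // mul1mx -/N.
    have := horner_char_poly (M *m N) 0; rewrite horner_coef0 -/chi chi_0 => /esym.
    rewrite raddf0 sub0r -scaleN1r detZ => /eqP; rewrite mulf_eq0 expf_eq0 oppr_eq0.
    by rewrite oner_eq0 andbF /= => /eqP.
  rewrite !det_mulmx => /eqP; rewrite !mulf_eq0.
  by move: uM; rewrite unitmxE unitfE => /negPf -> /eqP.
rewrite -mulNmx det_1DmulC mulmxN det_mx11 !mxE eqxx mulr1n => /eqP.
rewrite subr_eq0 => /eqP e; apply/matrixP => i j; rewrite !ord1 [RHS]mxE eqxx mulr1n e.
by rewrite -mulmxA mxE.
Qed.

(** For k < n, A^n M^k g = A^(n-k-1) (A g), so q A^n kills every M^k g. Controllability of (M, g)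
    gives q A^n = 0, and A^n is invertible. *)
Lemma controllable_inv (q : 'rV[R]_n) : (forall k, q *m (A ^+ k *m (A *m g)) = 0) -> q = 0.
Proof.
move=> hq; have AM : A * M = 1 by exact: mulVmx.
have cAM : GRing.comm A M by rewrite /GRing.comm AM; apply/esym; exact: mulmxV.
suff : q *m A ^+ n = 0.
  move=> e; have : q *m (A ^+ n *m M ^+ n) = 0 by rewrite mulmxA e mul0mx.
  suff -> : A ^+ n *m M ^+ n = 1%:M by rewrite mulmx1.
  rewrite -[_ *m _]/(A ^+ n * M ^+ n) -exprMn_comm ?AM ?expr1n //.
apply: ctrl => k kn; rewrite -mulmxA mulmxA -[RHS](hq (n - k.+1)%N) -!mulmxA.
congr (q *m _); rewrite !mulmxA; congr (_ *m g).
rewrite -[LHS]/(A ^+ n * M ^+ k) -[RHS]/(A ^+ _ * A) -exprSr.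
have -> : A ^+ n = A ^+ (n - k.+1).+1 * A ^+ k by rewrite -exprD; congr (_ ^+ _); lia.
by rewrite -mulrA -exprMn_comm // AM expr1n mulr1.
Qed.

(* This is 2 det(A)^2 det(1 + t M N): char_poly reversed, with its vanishing
   constant coefficient dropped. *)
Let d : {poly R} := (2 * (\det A) ^+ 2) *: \poly_(k < n) (chi`_(n - k) * (-1) ^+ k).

Lemma dim_gt0 : (0 < n)%N.
Proof.
rewrite lt0n; apply/eqP => n0.
have e0 k : k = 0%N -> chi`_k = 0 by move=> ->.
have := char_poly_monic (M *m N); rewrite monicE lead_coefE size_char_poly /= -/chi.
by rewrite e0 // eq_sym oner_eq0.
Qed.

Lemma rev_char_scale_gt0 : 0 < 2 * (\det A) ^+ 2.
Proof.
by rewrite pmulr_rgt0 // exprn_even_gt0 //=; have := inv_unitmx; rewrite unitmxE unitfE.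
Qed.

Lemma size_rev_char : size d = n.
Proof.
rewrite size_scale ?gt_eqF ?rev_char_scale_gt0 // size_poly_eq //.
(* The top coefficient is chi_1 up to sign, nonzero because the zero eigenvalue is simple. *)
have -> : (n - n.-1 = 1)%N by have := dim_gt0; lia.
by rewrite mulf_neq0 // signr_eq0.
Qed.

Lemma horner_rev_char t : t != 0 -> d.[t] = 2 * (\det A) ^+ 2 * \det (1%:M + t *: (M *m N)).
Proof.
move=> t0; rewrite hornerZ; congr (_ * _); rewrite horner_poly.
rewrite det_1DZ // -/chi (@horner_coef_wide _ n.+1) ?size_char_poly //.
rewrite big_ord_recl chi_0 mul0r add0r mulr_sumr.
rewrite (reindex_inj rev_ord_inj); apply: eq_bigr => k _ /=.
have -> : (n - (n - k.+1) = k.+1)%N by have := ltn_ord k; lia.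
have -> : (- t) ^+ n = (- t) ^+ (n - k.+1) * (- t) ^+ k.+1.
  by rewrite -exprD; congr (_ ^+ _); have := ltn_ord k; lia.
rewrite /bump /= add1n -[LHS]mulrA [RHS]mulrCA; congr (_ * _).
by rewrite -exprMn mulN1r -mulrA -exprMn mulrNN mulfV // expr1n mulr1.
Qed.

(** d(0) > 0 because chi is monic, and a zero t > 0 of d would make - 1/t a negative eigenvalue of M
    N; the intermediate value theorem then excludes a change of sign. *)
Lemma rev_char_gt0 t : 0 <= t -> 0 < d.[t].
Proof.
have d0 : 0 < d.[0].
  rewrite horner_coef0 coefZ coef_poly dim_gt0 subn0 expr0 mulr1.
  have := char_poly_monic (M *m N); rewrite monicE lead_coefE size_char_poly /= => /eqP ->.
  by rewrite mulr1 rev_char_scale_gt0.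
have dn0 s : 0 <= s -> d.[s] != 0.
  rewrite le_eqVlt => /orP[/eqP <-|s0]; first by rewrite gt_eqF.
  have sn0 : s != 0 by rewrite gt_eqF.
  rewrite horner_rev_char //; apply: mulf_neq0; first by rewrite gt_eqF ?rev_char_scale_gt0.
  rewrite det_1DZ //; apply: mulf_neq0; first by rewrite expf_neq0 ?oppr_eq0.
  by apply: chi_neg; rewrite oppr_lt0 invr_gt0.
move=> t0; rewrite ltNge; apply/negP => dt.
have [|x] := polyrcf.poly_ivt (p := d) t0; first by rewrite pmulr_rle0.
by rewrite in_itv /= => /andP[/dn0 + _] /rootP dx; rewrite dx eqxx.
Qed.

Let c : 'cV[R]_n := - (A^T *m h).
Let a := char_poly A.
Let y := res_eval A (A *m g).

(** With Z = (s - A)(- s - A) = A^2 - s^2 and w = Z^-1 g, y(u) = a(u) (- u - A) A w for u = s and u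
    = - s. Both sides equal 2 a(s) a(-s) h^T A^3 w: on the right, A^2 (1 - s^2 M N) = Z (1 + s^2 A w
    h^T), and h^T A g = 1 turns 1 + s^2 h^T A w into h^T A^3 w. *)
Lemma rev_char_real_part s : a.[s] != 0 -> a.[- s] != 0 -> s != 0 ->
  a.[- s] * (c^T *m y s) 0 0 + a.[s] * (c^T *m y (- s)) 0 0 = d.[- s ^+ 2].
Proof.
move=> as0 aNs0 s0.
pose X u : 'M[R]_n := u%:M - A; have detX u : \det (X u) = a.[u] by rewrite -horner_char_poly.
pose Z := A *m A - (s ^+ 2)%:M.
have XX u : X u *m X (- u) = A *m A - (u ^+ 2)%:M.
  rewrite /X mulmxBl !mulmxBr !mul_scalar_mx !mul_mx_scalar.
  rewrite scale_scalar_mx mulrN -expr2 raddfN /= scaleNr opprD !opprK.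
  by rewrite [LHS](AC (2*2) (4*1*(2*3))) /= addNr addr0.
have ZE := XX s; rewrite -/Z in ZE.
have detZ : \det Z = a.[s] * a.[- s] by rewrite -ZE det_mulmx !detX.
have uZ : Z \in unitmx by rewrite unitmxE unitfE detZ mulf_neq0.
pose w := invmx Z *m g; have Zw : Z *m w = g by rewrite mulKVmx.
clearbody w.
have ZA : Z *m A = A *m Z by rewrite /Z mulmxBl mulmxBr mul_scalar_mx mul_mx_scalar mulmxA.
have XA u : X u *m A = A *m X u by rewrite /X mulmxBl mulmxBr mul_scalar_mx mul_mx_scalar.
have yE u : a.[u] != 0 -> X u *m X (- u) = Z -> y u = a.[u] *: (X (- u) *m (A *m w)).
  move=> au0 XZ; have uX : X u \in unitmx by rewrite unitmxE unitfE detX.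
  apply: (can_inj (mulKmx uX)).
  have -> : X u *m y u = a.[u] *: (A *m g).
    by rewrite mulmxBl mul_scalar_mx res_evalE addrC addKr.
  by rewrite -scalemxAr !mulmxA XZ ZA -[_ *m w]mulmxA Zw.
have ZE' : X (- s) *m X s = Z by have := XX (- s); rewrite opprK sqrrN.
rewrite horner_rev_char ?oppr_eq0 ?expf_neq0 //.
have -> : (\det A) ^+ 2 = \det (A *m A) by rewrite det_mulmx expr2.
rewrite -mulrA -det_mulmx.
have -> : (A *m A) *m (1%:M + - s ^+ 2 *: (M *m N)) = Z *m (1%:M + (A *m w) *m (s ^+ 2 *: h^T)).
  rewrite [LHS]mulmxDr [RHS]mulmxDr !mulmx1 -!scalemxAr !mulmxA ZA -[A *m Z *m w]mulmxA Zw.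
  rewrite -[A *m A *m M]mulmxA mulVmx // mulmx1 -/A mulmxBr mulVmx // mulmxA.
  rewrite scalerBr !scaleNr opprK /Z addrA; congr (_ - _ + _).
  by rewrite scalemx1.
rewrite det_mulmx det_1DmulC detZ det_mx11.
have -> : y s = a.[s] *: (X (- s) *m (A *m w)) by rewrite yE.
have -> : y (- s) = a.[- s] *: (X s *m (A *m w)) by rewrite yE ?opprK.
have cX u t : (c^T *m (t *: (X u *m (A *m w)))) 0 0 =
    - t * (u * (h^T *m A *m (A *m w)) 0 0 - (h^T *m A *m (A *m (A *m w))) 0 0).
  have -> : c^T = - (h^T *m A) by rewrite /c linearN /= trmx_mul trmxK.
  rewrite /X mulmxBl mul_scalar_mx -scalemxAr mulNmx mulmxBr -scalemxAr scalerN -scaleNr.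
  by rewrite mx00Z mx00B mx00Z.
have sAw : s ^+ 2 *: (A *m w) = A *m (A *m (A *m w)) - A *m g.
  by rewrite -Zw /Z mulmxBl mul_scalar_mx mulmxBr -scalemxAr !mulmxA subKr.
have -> : (1%:M + s ^+ 2 *: h^T *m (A *m w)) 0 0 = (h^T *m A *m (A *m (A *m w))) 0 0.
  by rewrite -scalemxAl scalemxAr sAw mulmxBr !mulmxA gain_eq1 addrC subrK.
rewrite !cX; ring.
Qed.

Lemma rank_one_common_lyapunov : exists P Q, [/\ posdef P, posdef Q &
  forall x z : 'cV[R]_n, M *m z = x \/ N *m z = x ->
    (x^T *m P *m z) 0 0 *+ 2 = - (x^T *m Q *m x) 0 0].
Proof.
have [P [Q [pP pQ PE Pb]]] := kyp_strict controllable_inv stab size_rev_char rev_char_gt0 rev_char_real_part.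
exists P, Q; split => // x z xz.
have [sP _] := pP.
have {}Pb : P *m (A *m g) = c by [].
(* In mode 2, x = N z and v = h^T z, whence h^T A x = (1 - h^T A g) h^T z = 0. *)
have [v [zE vx]] : exists v : 'M[R]_1, z = A *m x + A *m g *m v /\ v *m (h^T *m A *m x) = 0.
  case: xz => <-.
    by exists 0; rewrite mulmx0 mul0mx addr0 mulKmx.
  have AN : A *m (N *m z) = z - A *m g *m (h^T *m z).
    by rewrite /N mulmxBl mulmxBr mulKmx // !mulmxA.
  exists (h^T *m z); rewrite AN subrK; split => //.
  rewrite -[h^T *m A *m _]mulmxA AN.
  rewrite [X in X *m _]mx11_scalar mul_scalar_mx.
  by rewrite mulmxBr !mulmxA gain_eq1 mul1mx subrr scaler0.
have Qx : (x^T *m Q *m x) 0 0 = - ((x^T *m P *m (A *m x)) 0 0 *+ 2).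
  rewrite -[Q]opprK -PE mulmxN mulNmx mulmxDr mulmxDl.
  have -> : x^T *m (A^T *m P) *m x = x^T *m P *m (A *m x).
    by rewrite -[LHS]trmx11 !trmx_mul !trmxK sP !mulmxA.
  by rewrite !mulmxA mxE [X in - X]mxE mulr2n.
rewrite Qx opprK zE mulmxDr mxE mulrnDl.
suff -> : x^T *m P *m (A *m g *m v) = 0 by rewrite [X in _ + X *+ 2]mxE mul0rn addr0.
rewrite !mulmxA -[x^T *m P *m A *m g]mulmxA -[x^T *m P *m _]mulmxA Pb /c.
rewrite mulmxN mulNmx -[X in - X]trmx11 !trmx_mul !trmxK.
by rewrite -[v]trmx11 trmxK vx oppr0.
Qed.
End RankOnePerturbation.

(** * Functional matrices *)

Section QuadraticForms.
Variables (F : realFieldType) (n : nat).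
Implicit Types (P B : 'M[F]_n) (x y : 'cV[F]_n).

Lemma sqnormE x : (x^T *m x) 0 0 = \sum_i x i 0 ^+ 2.
Proof. by rewrite mxE; apply: eq_bigr => i _; rewrite mxE expr2. Qed.

Lemma quad_form_upper B : exists2 k, 0 < k &
  forall x, (x^T *m B *m x) 0 0 <= k * (x^T *m x) 0 0.
Proof.
(* The leading 1 keeps the constant positive even when B = 0. *)
exists (1 + \sum_i \sum_j `|B i j|).
  by rewrite ltr_pwDl // sumr_ge0 // => i _; apply: sumr_ge0.
move=> x; set S := (x^T *m x) 0 0.
have xS i : x i 0 ^+ 2 <= S.
  rewrite /S sqnormE (bigD1 i) //= lerDl sumr_ge0 // => j _; exact: sqr_ge0.
have S0 : 0 <= S by rewrite /S sqnormE sumr_ge0 // => i _; exact: sqr_ge0.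
rewrite mulrDl mul1r ler_wpDl // mulr_suml -mulmxA mxE ler_sum // => i _.
rewrite [x^T _ _]mxE mxE mulr_sumr mulr_suml ler_sum // => j _.
rewrite (le_trans (ler_norm _)) // !normrM mulrCA ler_wpM2l //.
have := xS i; have := xS j; rewrite -[x i 0 ^+ 2]real_normK ?num_real // -[x j 0 ^+ 2]real_normK ?num_real //.
have := sqr_ge0 (`|x i 0| - `|x j 0|); nra.
Qed.

(* Expanding the form at x - k^-1 P x bounds it below by |P x|^2. *)
Lemma posdef_lower P : posdef P -> exists2 k, 0 < k &
  forall x, k * (x^T *m x) 0 0 <= (x^T *m P *m x) 0 0.
Proof.
move=> [sP pP]; have uP : P \in unitmx.
  rewrite unitmxE unitfE; apply/negP => /det0P[v v0 vP].
  have := pP v^T; rewrite trmxK vP mul0mx mxE ltxx => /(_ _)/negP; apply=> //.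
  by rewrite trmx_eq0.
have [k k0 hk] := quad_form_upper P.
have [l l0 hl] := quad_form_upper ((invmx P)^T *m invmx P).
(* From |x|^2 <= l |P x|^2 and |P x|^2 <= k x^T P x. *)
exists ((k * l)^-1) => [|x]; first by rewrite invr_gt0 mulr_gt0.
have [y yE] : exists y, y = P *m x by exists (P *m x).
have xy : (x^T *m x) 0 0 <= l * (y^T *m y) 0 0.
  have iy : invmx P *m y = x by rewrite yE mulKmx.
  by have := hl y; rewrite mulmxA -trmx_mul -mulmxA iy.
have yx : k^-1 * (y^T *m y) 0 0 <= (x^T *m P *m x) 0 0.
  have : 0 <= ((x - k^-1 *: y)^T *m P *m (x - k^-1 *: y)) 0 0.
    have [->|/pP/ltW//] := eqVneq (x - k^-1 *: y) 0; by rewrite mulmx0 mxE.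
  have xPy : x^T *m P *m y = y^T *m y by rewrite {2}yE trmx_mul sP.
  have yPx : y^T *m P *m x = y^T *m y by rewrite -mulmxA -yE.
  have -> : (x - k^-1 *: y)^T = x^T - k^-1 *: y^T by rewrite linearB linearZ.
  rewrite !mulmxBl !mulmxBr -!scalemxAl -!scalemxAr xPy yPx.
  rewrite !mx00B !mx00Z; have := hk y; set qy := (y^T *m P *m y) 0 0; set Y := (y^T *m y) 0 0.
  move=> qyk h; have : k^-1 * (k^-1 * qy) <= k^-1 * Y.
    by rewrite ler_pM2l ?invr_gt0 // ler_pdivrMl.
  lra.
rewrite invfM; apply: le_trans yx; rewrite -mulrA ler_pM2l ?invr_gt0 //.
by rewrite ler_pdivrMl.
Qed.
End QuadraticForms.

Definition mx n (B : Mat) : 'M[R]_n := \matrix_(i, j) B i j.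
Definition cv n (x : Vec) : 'cV[R]_n := \col_i x i.
Definition vec_of n (x : 'cV[R]_n) : Vec :=
  fun i => if insub i is Some j then x j 0 else 0.

Lemma vec_ofK n (x : 'cV[R]_n) : cv n (vec_of x) = x.
Proof. by apply/matrixP => i j; rewrite mxE ord1 /vec_of valK. Qed.

Definition mat_of n (B : 'M[R]_n) : Mat := fun i j =>
  if insub i is Some i' then if insub j is Some j' then B i' j' else 0 else 0.

Lemma mat_ofK n (B : 'M[R]_n) : mx n (mat_of B) = B.
Proof. by apply/matrixP => i j; rewrite mxE /mat_of !valK. Qed.

Lemma cvP n (x z : Vec) : (forall i, (i < n)%coq_nat -> x i = z i) <-> cv n x = cv n z.
Proof.
split=> [e|/matrixP e i /ssrnat.ltP hi].
  by apply/matrixP => i j; rewrite !mxE; apply/e/ssrnat.ltP.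
by have := e (Ordinal hi) 0; rewrite !mxE.
Qed.

Lemma mxP n (B B' : Mat) :
  (forall i j, (i < n)%coq_nat -> (j < n)%coq_nat -> B i j = B' i j) ->
  mx n B = mx n B'.
Proof. by move=> e; apply/matrixP => i j; rewrite !mxE; apply: e; apply/ssrnat.ltP. Qed.

Lemma rsumE n f : rsum n f = \sum_(i < n) f i.
Proof. by elim: n => [|n IH] /=; rewrite ?big_ord0 // big_ord_recr /= IH. Qed.

Lemma mx_mmul n B B' : mx n (mmul n B B') = mx n B *m mx n B'.
Proof.
apply/matrixP => i j; rewrite !mxE /mmul rsumE.
by apply: eq_bigr => k _; rewrite !mxE.
Qed.

Lemma cv_mvec n B x : cv n (mvec n B x) = mx n B *m cv n x.
Proof.
apply/matrixP => i j; rewrite !mxE /mvec rsumE.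
by apply: eq_bigr => k _; rewrite !mxE.
Qed.

Lemma mx_idm n : mx n idm = 1%:M.
Proof.
apply/matrixP => i j; rewrite !mxE /idm -val_eqE /=.
by have [->|/eqP/Nat.eqb_neq ->] := eqVneq (i : nat) j; rewrite ?Nat.eqb_refl.
Qed.

Lemma mx_mpow n B k : mx n (mpow n B k) = mx n B ^+ k.
Proof. by elim: k => [|k IH]; [exact: mx_idm|rewrite exprS /= mx_mmul IH]. Qed.

Lemma bilinE n P x z : bilin n P x z = ((cv n x)^T *m mx n P *m cv n z) 0 0.
Proof.
rewrite /bilin rsumE -mulmxA -cv_mvec mxE.
by apply: eq_bigr => i _; rewrite !mxE.
Qed.

Lemma minorE (T : Type) n (j : 'I_n.+1) (B : nat -> nat -> T) :
  \matrix_(i < n, k < n) minor j B i k = row' ord0 (col' j (\matrix_(i, k) B i k)).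
Proof.
apply/matrixP => i k; rewrite !mxE /minor /= /bump add1n; congr B.
by case: Nat.ltb_spec => [/ssrnat.ltP h|/ssrnat.leP ->] //; rewrite leqNgt h.
Qed.

Lemma detRE n B : detR n B = \det (mx n B).
Proof.
elim: n B => [|n IH] B; first by rewrite det_mx00.
rewrite (expand_det_row _ ord0) /detR -/detR rsumE; apply: eq_bigr => j _.
rewrite IH /mx minorE /cofactor mxE RpowE add0n.
by rewrite !RmultE; ring.
Qed.

Definition toComplex (z : Defs.C) : R[i] := Complex (Cre z) (Cim z).

Lemma toComplexM a b : toComplex (Cmul a b) = toComplex a * toComplex b.
Proof. by []. Qed.

Lemma csumE n f : toComplex (csum n f) = \sum_(i < n) toComplex (f i).
Proof. by elim: n => [|n IH] /=; rewrite ?big_ord0 // big_ord_recr /= -IH. Qed.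

Lemma detCE n B : toComplex (detC n B) = \det (\matrix_(i < n, j < n) toComplex (B i j)).
Proof.
elim: n B => [|n IH] B; first by rewrite det_mx00.
rewrite (expand_det_row _ ord0) /detC -/detC csumE; apply: eq_bigr => j _.
rewrite !toComplexM IH /cofactor mxE mulrCA; congr (_ * (_ * _)).
  by rewrite /toComplex /RtoC /= RpowE add0n -[LHS]/((real_complex R) _) rmorphXn rmorphN1.
congr (\det _); rewrite -(minorE j (fun i k => toComplex (B i k))).
by apply/matrixP => i k; rewrite !mxE.
Qed.

Lemma charpolyE n P l : charpoly n P l = (char_poly (mx n P)).[l].
Proof.
rewrite horner_char_poly /charpoly detRE; congr (\det _).
rewrite -scalemx1 -mx_idm; apply/matrixP => i j; by rewrite !mxE.
Qed.

Lemma derivable_pt_lim_horner (p : {poly R}) (x : R) :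
  derivable_pt_lim (fun t => p.[t]) x (p^`()).[x].
Proof.
elim/poly_ind: p => [|p c IH].
  rewrite deriv0 horner0.
  apply: (derivable_pt_lim_ext (fun=> 0%R)); last exact: derivable_pt_lim_const.
  by move=> t; rewrite horner0.
have -> : ((p * 'X + c%:P)^`()).[x] = ((p^`()).[x] * x + p.[x] * 1) + 0.
  by rewrite derivMXaddC hornerD hornerM hornerX mulr1 addr0 addrC.
apply: (derivable_pt_lim_ext (plus_fct (mult_fct (fun t => p.[t]) id) (fct_cte c))).
  by move=> t; rewrite !hornerE.
apply: derivable_pt_lim_plus; last exact: derivable_pt_lim_const.
by apply: derivable_pt_lim_mult => //; exact: derivable_pt_lim_id.
Qed.

(** Turns the simplicity of the zero eigenvalue, given as a nonzero derivative at 0, into the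
    nonzero linear coefficient used by the algebraic part. *)
Lemma charpoly_derive0 n P l : derivable_pt_lim (charpoly n P) 0 l ->
  l = (char_poly (mx n P))`_1.
Proof.
move=> dl; have := derivable_pt_lim_horner (char_poly (mx n P)) 0.
rewrite horner_coef0 coef_deriv mulr1n => dp.
apply: (uniqueness_limite _ _ _ _ dl).
by apply: (derivable_pt_lim_ext _ _ _ _ _ dp) => t; rewrite charpolyE.
Qed.

(** Index zero says that M is onto. A left null vector v kills the image of M, hence v^T itself, and
    v v^T is a sum of squares. *)
Lemma has_index0_unit n E Ainv : has_index n E Ainv 0 ->
  mx n (mmul n Ainv E) \in unitmx.
Proof.
move=> [sI _]; set M := mmul n Ainv E in sI *.
rewrite unitmxE unitfE; apply/negP => /det0P[v v0 vM].
have [_] := sI (vec_of v^T); case=> [|x].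
  exists (vec_of v^T); apply/cvP; rewrite cv_mvec mx_idm mul1mx //.
move/cvP; rewrite vec_ofK cv_mvec mx_mpow expr1 => /(congr1 (mulmx v)).
rewrite mulmxA vM mul0mx => /matrixP/(_ 0 0); rewrite mxE [RHS]mxE => /eqP.
rewrite psumr_eq0 => [/allP h|i _]; last by rewrite mxE -expr2 sqr_ge0.
move: v0 => /eqP[]; apply/matrixP => i j; rewrite ord1 [RHS]mxE.
have /implyP/(_ isT) := h j (mem_index_enum _).
by rewrite mxE mulf_eq0 orbb => /eqP.
Qed.

(** Expanding q^T itself along the M^k g gives q q^T = 0. *)
Lemma controllable_sep n M g : controllable n M g ->
  forall q : 'rV[R]_n, (forall k, (k < n)%N -> q *m (mx n M ^+ k *m cv n g) = 0) -> q = 0.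
Proof.
move=> cM q hq; have [c] := cM (vec_of q^T).
rewrite (cvP _ _ (fun i => rsum n (fun k => Rmult (c k) (mvec n (mpow n M k) g i)))).
have -> : cv n (fun i => rsum n (fun k => Rmult (c k) (mvec n (mpow n M k) g i))) =
    \sum_(k < n) c k *: (mx n M ^+ k *m cv n g).
  apply/matrixP => i j; rewrite mxE rsumE summxE; apply: eq_bigr => k _.
  by rewrite -mx_mpow -cv_mvec !mxE.
rewrite vec_ofK => /(congr1 (mulmx q)); rewrite mulmx_sumr big1; last first.
  by move=> k _; rewrite -scalemxAr hq ?scaler0.
move=> /matrixP/(_ 0 0); rewrite mxE [RHS]mxE => /eqP.
rewrite psumr_eq0 => [/allP h|i _]; last by rewrite mxE -expr2 sqr_ge0.
apply/matrixP => i j; rewrite ord1 [RHS]mxE.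
have /implyP/(_ isT) := h j (mem_index_enum _).
by rewrite mxE mulf_eq0 orbb => /eqP.
Qed.

Lemma is_inverse_mx n A Ainv : is_inverse n A Ainv ->
  mx n A *m mx n Ainv = 1%:M /\ mx n Ainv *m mx n A = 1%:M.
Proof.
by move=> hi; rewrite -!mx_mmul -mx_idm; split; apply: mxP => i j hi' hj; have [] := hi i j hi' hj.
Qed.

(** With M = A^-1 E, s E - A = E (s - M^-1), so every eigenvalue of M^-1 is a root of det(s E -
    A). *)
Lemma stable_eigenvalue n E A Ainv : is_inverse n A Ainv -> stable n E A ->
  mx n (mmul n Ainv E) \in unitmx ->
  forall s : R[i], \det (s%:M - toC (invmx (mx n (mmul n Ainv E)))) = 0 ->
  complex.Re s < 0.
Proof.
move=> /is_inverse_mx[AAi _] st uM [a b] /= ds.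
apply/RltP; apply: (st (mkC a b)).
set s : R[i] := Complex a b in ds *.
have inj (z : Defs.C) : toComplex z = 0 -> z = C0 by case: z => x y [-> ->].
apply: inj; rewrite detCE.
have -> : \matrix_(i < n, j < n) toComplex
    (Cadd (Cmul (mkC a b) (RtoC (E i j))) (RtoC (Ropp (A i j)))) =
    s *: toC (mx n E) - toC (mx n A).
  apply/matrixP => i j; rewrite !mxE; apply/eqP; rewrite eq_complex /=.
  by rewrite oppr0 !eqxx.
set M := mx n (mmul n Ainv E) in uM ds *.
have EE : mx n E = mx n A *m M by rewrite /M mx_mmul mulmxA AAi mul1mx.
have -> : s *: toC (mx n E) - toC (mx n A) = toC (mx n E) *m (s%:M - toC (invmx M)).
  by rewrite mulmxBr mul_mx_scalar -map_mxM EE mulmxK.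
by rewrite det_mulmx ds mulr0.
Qed.

Lemma sel_inverse n E A Ainv x z : is_inverse n A Ainv ->
  (forall i, (i < n)%coq_nat -> mvec n E z i = mvec n A x i) ->
  mx n (mmul n Ainv E) *m cv n z = cv n x.
Proof.
move=> /is_inverse_mx[_ AiA] /cvP; rewrite !cv_mvec mx_mmul -mulmxA => ->.
by rewrite mulmxA AiA mul1mx.
Qed.

Lemma rank_one_gues n E1 A1 E2 A2 A1inv A2inv g h :
  is_inverse n A1 A1inv -> is_inverse n A2 A2inv ->
  stable n E1 A1 -> has_index n E1 A1inv 0 ->
  (forall i j, (i < n)%coq_nat -> (j < n)%coq_nat ->
     mmul n A2inv E2 i j = Rminus (mmul n A1inv E1 i j) (Rmult (g i) (h j))) ->
  controllable n (mmul n A1inv E1) g ->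
  let P := mmul n (mmul n A1inv E1) (mmul n A2inv E2) in
  (forall l, Rlt l R0 -> charpoly n P l <> R0) ->
  charpoly n P R0 = R0 ->
  (exists l, l <> R0 /\ derivable_pt_lim (charpoly n P) R0 l) ->
  GUES n E1 A1 E2 A2.
Proof.
move=> i1 i2 st1 ind0 rk1 ctrl P0 neg zero [l [l0 dl]].
have uM := has_index0_unit ind0.
set M := mx n (mmul n A1inv E1) in uM.
have NE : mx n (mmul n A2inv E2) = M - cv n g *m (cv n h)^T.
  apply/matrixP => i j; rewrite mxE rk1; try exact/ssrnat.ltP.
  by rewrite !mxE big_ord1 !mxE.
have PE : mx n P0 = M *m (M - cv n g *m (cv n h)^T) by rewrite /P0 mx_mmul NE.
have [|||P [Q [pP pQ PQ]]] := rank_one_common_lyapunov uM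
  (stable_eigenvalue i1 st1 uM) (controllable_sep ctrl) (h := cv n h).
- by move=> r /RltP r0; rewrite -PE -charpolyE; apply/eqP/neg.
- by rewrite -PE -horner_coef0 -charpolyE.
- by rewrite -PE -(charpoly_derive0 dl); apply/eqP.
have [k1 k1_gt0 lo] := posdef_lower pP.
have [k2 k2_gt0 up] := quad_form_upper P.
have [q q_gt0 loQ] := posdef_lower pQ.
have sqE x : rsum n (fun i => pow (x i) 2) = ((cv n x)^T *m cv n x) 0 0.
  rewrite rsumE sqnormE; apply: eq_bigr => i _; by rewrite RpowE mxE.
(* The rate comes from x^T Q x >= q |x|^2 >= (q / k2) x^T P x. *)
apply: (@gues_of_quadratic_lyapunov n E1 A1 E2 A2 (mat_of P) k1 k2 (q / k2)).
- exact/RltP.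
- exact/RltP.
- by apply/RltP; rewrite divr_gt0.
- by move=> x; apply/RleP; rewrite bilinE mat_ofK sqE.
- by move=> x; apply/RleP; rewrite bilinE mat_ofK sqE.
move=> k x z k12 hk; apply/RleP; rewrite !bilinE !mat_ofK.
have xz : M *m cv n z = cv n x \/ (M - cv n g *m (cv n h)^T) *m cv n z = cv n x.
  case: k12 hk => ->; first by move=> /(sel_inverse i1) ?; left.
  by rewrite -NE => /(sel_inverse i2) ?; right.
have -> : (cv n z)^T *m P *m cv n x = (cv n x)^T *m P *m cv n z.
  by rewrite -[LHS]trmx11 !trmx_mul trmxK pP.1 mulmxA.
rewrite RplusE RmultE RoppE -mulr2n (PQ _ _ xz) mulNr lerN2.
apply: le_trans (loQ _); rewrite -mulrA ler_pM2l // ler_pdivrMl //.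
Qed.

End CommonLyapunov.

Theorem theorem3 (n : nat) (E1 A1 E2 A2 A1inv A2inv : Mat) (g h : Vec) :
  is_inverse n A1 A1inv -> is_inverse n A2 A2inv ->
  (* (a) *)
  stable n E1 A1 -> stable n E2 A2 ->
  (* (b) *)
  has_index n E1 A1inv 0 -> has_index n E2 A2inv 1 ->
  (* (c) *)
  (forall i j, (i < n)%nat -> (j < n)%nat ->
     mmul n A2inv E2 i j = mmul n A1inv E1 i j - g i * h j) ->
  controllable n (mmul n A1inv E1) g ->
  observable n (mmul n A1inv E1) h ->
  (* (d) *)
  (let P := mmul n (mmul n A1inv E1) (mmul n A2inv E2) in
   (forall lam, lam < 0 -> charpoly n P lam <> 0) /\
   charpoly n P 0 = 0 /\
   (exists l, l <> 0 /\ derivable_pt_lim (charpoly n P) 0 l)) ->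
  GUES n E1 A1 E2 A2.
Proof.
intros i1 i2 st1 _ ind0 _ rk1 ctrl _ [neg [zero simple]].
exact (CommonLyapunov.rank_one_gues i1 i2 st1 ind0 rk1 ctrl neg zero simple).
Qed.
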